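(* Let $(A_n)_n,(\tilde A_n)_n\in\mathcal{A}^M_5$ and let $(S_n)_n$, $(\tilde S_n)_n$ be the g.e.i.s.'s generated by $(A_n)_n$ and $(\tilde A_n)_n$, respectively. If $(A_n)_n\simeq_0(\tilde A_n)_n$, then $(S_n)_n\simeq(\tilde S_n)_n$.
   Context: $(X,\|\cdot\|_X)$ is a (complex) Banach space and $\mathcal{L}(X)$ the Banach algebra of bounded linear operators on $X$. For a Banach space $Y$, $(y_n)_n\in\mathcal{E}^M_Y$ (moderate) means there is $a\in\mathbb R$ with $\|y_n\|_Y=\mathcal O(n^a)$ as $n\to\infty$. $\mathcal{C}^M_{\rm exp}([0,\infty);X)$ is the space of sequences of continuous maps $F_n:[0,\infty)\to X$ with $\sup_{t\ge0}\|e^{-\omega t}F_n(t)\|_X=\mathcal O(n^a)$ for some $\omega>0$, $a\in\mathbb R$; $\mathcal{C}^M_{\rm exp}([0,\infty);\mathcal{L}(X))$ is the analogous space of sequences of strongly continuous maps $S_n:[0,\infty)\to\mathcal{L}(X)$ (with the $\mathcal{L}(X)$-norm). $\mathcal{I}_{\rm exp}([0,\infty);X)$ is the subspace of those $(N_n)_n\in\mathcal{C}^M_{\rm exp}([0,\infty);X)$ with $\sup_{t\ge0}\|e^{-\omega t}N_n(t)\|_X\to0$ as $n\to\infty$ for some $\omega>0$. $\mathcal{A}^M_5$ is the set of sequences $(A_n)_n$ of closed linear operators in $X$ such that: (G1) there is $D\subset X$, $D\ne\emptyset$, with $D_{A_n}=D$ for all $n$; (G2) there is $\omega>0$ with $(\omega,\infty)\subset\rho(A_n)$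 for all $n$; (G3) $(R(\lambda,A_n))_n\in\mathcal{E}^M_{\mathcal{L}(X)}$ for every $\lambda\in(\omega,\infty)$; (G4) for every $\lambda>\omega$ there exist $0<c_1(\lambda)<c_2(\lambda)$ with $\|R(\lambda,A_n)\|_{\mathcal{L}(X)}\in(c_1(\lambda),c_2(\lambda))$ for all $n$; (G5) $\sup_{\mathrm{Re}\,\lambda>\omega}\|\lambda^bR(\lambda,A_n)\|_{\mathcal{L}(X)}\le M_n$, $n\in\mathbb N$, for some $b>0$ and some $(M_n)_n\in\mathcal{E}^M_{\mathbb R}$ (in particular $\{\mathrm{Re}\,\lambda>\omega\}\subset\rho(A_n)$). For two such sequences a common $\omega$ is used. A sequence $(A_n)_n$ satisfying (G1)–(G3) generates the g.e.i.s. (sequence of exponentially bounded integrated semigroups) $(S_n)_n$ if $(S_n)_n\in\mathcal{C}^M_{\rm exp}([0,\infty);\mathcal{L}(X))$ and $R(\lambda,A_n)=\lambda\int_0^\infty e^{-\lambda t}S_n(t)\,dt$ for all sufficiently large real $\lambda$ and all $n\in\mathbb N$; every element of $\mathcal{A}^M_5$ generates a g.e.i.s. Set $\mathbf{D}_A=\{(x_n)_n\in\mathcal{E}^M_X:\ x_n\in D\ \forall n,\ (A_nx_n)_n\in\mathcal{E}^M_X\}$ and $\mathbf{R}_A=\{(x_n)_n\in\mathcal{E}^M_X:\ \exists (y_n)_n\in\mathcal{E}^M_X,\ R(\lambda,A_n)y_n=x_n\ \forall n\}$ (independent of $\lambda\in(\omega,\infty)$); similarly for $(\tilde A_n)_n$.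 $(A_n)_n\simeq(\tilde A_n)_n$ means: $D_{A_n}=D_{\tilde A_n}=D$ for all $n$; $\mathbf{D}_A=\mathbf{D}_{\tilde A}$; and $(A_n-\tilde A_n)x_n\to0$ in $X$ as $n\to\infty$ for every $(x_n)_n\in\mathbf{D}_A$. $(A_n)_n\simeq_0(\tilde A_n)_n$ means: $(A_n)_n\simeq(\tilde A_n)_n$ and (GE4) there exists $b>0$ such that $\sup_{\mathrm{Re}\,\lambda>\omega}\|\lambda^b(R(\lambda,A_n)-R(\lambda,\tilde A_n))x_n\|_X\to0$ as $n\to\infty$ for all $(x_n)_n\in\mathcal{E}^M_X$. $(S_n)_n\simeq(\tilde S_n)_n$ means: $((S_n-\tilde S_n)x_n)_n\in\mathcal{I}_{\rm exp}([0,\infty);X)$ for every $(x_n)_n\in\mathcal{E}^M_X$, and for every $\lambda\in(\omega,\infty)$ (RE1) there is a set $R$ with $R=\mathrm{range}\,R(\lambda,A_n)=\mathrm{range}\,R(\lambda,\tilde A_n)$ for all $n$, and (RE2) $\mathbf{R}_A=\mathbf{R}_{\tilde A}$. *)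

(* Defs.v *)
From Stdlib Require Import Reals Lra.
From Coquelicot Require Import Coquelicot.

Set Implicit Arguments.
Unset Strict Implicit.
Unset Printing Implicit Defensive.

Open Scope R_scope.

(** A complex Banach space is a [CompleteNormedModule C_AbsRing].  Coquelicot's
    Riemann integral is only available on real normed modules, so we restrict
    the scalars; group, norm and uniform structure are unchanged. *)

Section Realification.

Variable X : CompleteNormedModule C_AbsRing.

Definition realification : Type := X.

Canonical realif_AbelianMonoid : AbelianMonoid :=
  AbelianMonoid.Pack realification (AbelianMonoid.class X) realification.

Canonical realif_AbelianGroup : AbelianGroup :=
  AbelianGroup.Pack realification (AbelianGroup.class X) realification.

Definition realif_scal (r : R) (x : realification) : realification :=
  scal (RtoC r : C_AbsRing) (x : X).

Lemma realif_scal_assoc (r s : R) (x : realification) :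
  realif_scal r (realif_scal s x) = realif_scal (mult r s) x.
Proof.
unfold realif_scal; rewrite scal_assoc; apply (f_equal (fun c => scal c (x : X))).
symmetry; exact (RtoC_mult r s).
Qed.

Lemma realif_scal_one (x : realification) : realif_scal one x = x.
Proof. exact (scal_one (x : X)). Qed.

Lemma realif_scal_distr_l (r : R) (x y : realification) :
  realif_scal r (plus x y) = plus (realif_scal r x) (realif_scal r y).
Proof. exact (scal_distr_l (RtoC r : C_AbsRing) (x : X) y). Qed.

Lemma realif_scal_distr_r (r s : R) (x : realification) :
  realif_scal (plus r s) x = plus (realif_scal r x) (realif_scal s x).
Proof.
apply eq_trans with (2 := scal_distr_r (RtoC r : C_AbsRing) (RtoC s) (x : X)).
apply (f_equal (fun c => scal (c : C_AbsRing) (x : X))); exact (RtoC_plus r s).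
Qed.

Definition realif_ModuleSpace_mixin :=
  ModuleSpace.Mixin R_Ring realif_AbelianGroup realif_scal
    realif_scal_assoc realif_scal_one realif_scal_distr_l realif_scal_distr_r.

Canonical realif_ModuleSpace : ModuleSpace R_Ring :=
  ModuleSpace.Pack R_Ring realification
    (ModuleSpace.Class R_Ring realification _ realif_ModuleSpace_mixin)
    realification.

Canonical realif_UniformSpace : UniformSpace :=
  UniformSpace.Pack realification (UniformSpace.class X) realification.

Canonical realif_NormedModuleAux : NormedModuleAux R_AbsRing :=
  NormedModuleAux.Pack R_AbsRing realification
    (NormedModuleAux.Class R_AbsRing realification
       (ModuleSpace.class R_Ring realif_ModuleSpace)
       (UniformSpace.class realif_UniformSpace))
    realification.

Lemma realif_norm_scal (r : R_AbsRing) (x : realification) :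
  norm (scal r x : X) <= abs r * norm (x : X).
Proof.
apply Rle_trans with (1 := norm_scal (RtoC r : C_AbsRing) (x : X)).
apply Req_le; f_equal; exact (Cmod_R r).
Qed.

Definition realif_NormedModule_mixin :=
  NormedModule.Mixin R_AbsRing realif_NormedModuleAux
    (fun x => norm (x : X)) (@norm_factor _ X)
    (@norm_triangle _ X) realif_norm_scal
    (@norm_compat1 _ X) (@norm_compat2 _ X) (@norm_eq_zero _ X).

Canonical realif_NormedModule : NormedModule R_AbsRing :=
  NormedModule.Pack R_AbsRing realification
    (NormedModule.Class R_AbsRing realification _ realif_NormedModule_mixin)
    realification.

Canonical realif_CompleteSpace : CompleteSpace :=
  CompleteSpace.Pack realification (CompleteSpace.class X) realification.

Canonical realif_CompleteNormedModule : CompleteNormedModule R_AbsRing :=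
  CompleteNormedModule.Pack R_AbsRing realification
    (CompleteNormedModule.Class R_AbsRing realification
       (NormedModule.class R_AbsRing realif_NormedModule)
       (CompleteSpace.mixin _ (CompleteSpace.class X)))
    realification.

End Realification.

(** Principal branch of the argument, for [z] outside [(-oo, 0]]
    (half-angle formula). *)
Definition Carg (z : C) : R := 2 * atan (Im z / (Cmod z + Re z)).

Definition Cpower (z : C) (b : R) : C :=
  (RtoC (Rpower (Cmod z) b) * (cos (b * Carg z), sin (b * Carg z)))%C.

Definition sup_over {T : Type} (D : T -> Prop) (f : T -> R) : Rbar :=
  Lub_Rbar (fun r => exists t, D t /\ r = f t).

(** [u n = O(n^a)] for some real [a]; [u] is a nonnegative sequence that may
    take the value [+oo] at finitely many indices. *)
Definition poly_bounded (u : nat -> Rbar) : Prop :=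
  exists a c : R,
    eventually (fun n => Rbar_le (u n) (Finite (c * Rpower (INR n) a))).

Definition tends_to_0 (u : nat -> Rbar) : Prop :=
  forall eps : posreal,
    eventually (fun n => Rbar_lt (Rbar_abs (u n)) (Finite eps)).

Definition moderate {K : AbsRing} {V : NormedModule K} (x : nat -> V) : Prop :=
  poly_bounded (fun n => Finite (norm (x n))).

Section Operators.

Variable X : CompleteNormedModule C_AbsRing.

(** The elements of L(X) are the [T : X -> X] with [is_linear T], Coquelicot's
    predicate for bounded linear maps; for those the supremum is finite. *)
Definition opnorm (T : X -> X) : R :=
  real (sup_over (fun x => norm x <= 1) (fun x => norm (T x))).

Definition moderate_op (T : nat -> X -> X) : Prop :=
  poly_bounded (fun n => Finite (opnorm (T n))).

(** The values of [op] outside [dom] are meaningless. *)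
Record closed_operator := ClosedOperator {
  dom : X -> Prop;
  op :> X -> X;
  dom_zero : dom zero;
  dom_plus : forall x y, dom x -> dom y -> dom (plus x y);
  dom_scal : forall (k : C) x, dom x -> dom (scal (k : C_AbsRing) x);
  op_plus : forall x y, dom x -> dom y -> op (plus x y) = plus (op x) (op y);
  op_scal : forall (k : C) x, dom x ->
    op (scal (k : C_AbsRing) x) = scal (k : C_AbsRing) (op x);
  closed_graph : closed (fun p : X * X => dom (fst p) /\ op (fst p) = snd p)
}.

Definition resolvent_eq (A : closed_operator) (lam : C) (y x : X) : Prop :=
  dom A x /\ minus (scal (lam : C_AbsRing) x) (A x) = y.

(** [R(lam, A) y = (lam - A)^-1 y]; meaningful for [lam] in the resolvent set. *)
Definition resolvent (A : closed_operator) (lam : C) (y : X) : X :=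
  iota (resolvent_eq A lam y).

Definition resolvent_set (A : closed_operator) (lam : C) : Prop :=
  (forall y, exists! x, resolvent_eq A lam y x) /\ is_linear (resolvent A lam).

Definition half_line (t : R) : Prop := 0 <= t.

Definition half_plane (omega : R) (lam : C) : Prop := omega < Re lam.

(** [sup_{t >= 0} || e^(- omega t) F(t) ||] *)
Definition exp_sup (omega : R) (F : R -> X) : Rbar :=
  sup_over half_line
    (fun t => norm (scal (RtoC (exp (- omega * t)) : C_AbsRing) (F t))).

Definition exp_sup_op (omega : R) (S : R -> X -> X) : Rbar :=
  sup_over half_line
    (fun t => opnorm
       (fun x => scal (RtoC (exp (- omega * t)) : C_AbsRing) (S t x))).

(** The suprema are real numbers, i.e. every member of the sequence is
    exponentially bounded with the common exponent [omega]. *)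
Definition C_exp (F : nat -> R -> X) : Prop :=
  (forall n, continuous_on half_line (F n)) /\
  exists omega : R, 0 < omega /\
    (forall n, is_finite (exp_sup omega (F n))) /\
    poly_bounded (fun n => exp_sup omega (F n)).

Definition C_exp_op (S : nat -> R -> X -> X) : Prop :=
  (forall n t, half_line t -> is_linear (S n t)) /\
  (forall n x, continuous_on half_line (fun t => S n t x)) /\
  exists omega : R, 0 < omega /\
    (forall n, is_finite (exp_sup_op omega (S n))) /\
    poly_bounded (fun n => exp_sup_op omega (S n)).

Definition I_exp (N : nat -> R -> X) : Prop :=
  C_exp N /\
  exists omega : R, 0 < omega /\ tends_to_0 (fun n => exp_sup omega (N n)).

(** [omega] is a parameter, not existentially quantified, because two sequences
    are compared with a common [omega]. *)
Record A5 (omega : R) (A : nat -> closed_operator) : Prop := {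
  A5_omega_pos : 0 < omega;
  A5_domain : exists D : X -> Prop, (exists x, D x) /\
    forall n x, dom (A n) x <-> D x;
  A5_resolvent_set : forall n (lam : R), omega < lam -> resolvent_set (A n) lam;
  A5_moderate : forall lam : R, omega < lam ->
    moderate_op (fun n => resolvent (A n) lam);
  A5_norm_bounds : forall lam : R, omega < lam -> exists c1 c2 : R, 0 < c1 < c2 /\
    forall n, c1 < opnorm (resolvent (A n) lam) < c2;
  A5_half_plane_bound : exists b : R, 0 < b /\ exists M : nat -> R, moderate M /\
    forall n,
      (forall lam : C, half_plane omega lam -> resolvent_set (A n) lam) /\
      Rbar_le
        (sup_over (half_plane omega) (fun lam => opnorm
           (fun x => scal (Cpower lam b : C_AbsRing) (resolvent (A n) lam x))))
        (Finite (M n))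
}.

(** [R(lam, A n) x = lam int_0^oo e^(- lam t) S_n(t) x dt] for every [x]: the
    integral of the strongly continuous [S_n] is taken in the strong sense. *)
Definition generates (A : nat -> closed_operator) (S : nat -> R -> X -> X)
  : Prop :=
  C_exp_op S /\
  exists lam0 : R, forall lam : R, lam0 < lam -> forall n (x : X),
    exists J : X,
      is_RInt_gen
        (fun t => scal (RtoC (exp (- lam * t)) : C_AbsRing) (S n t x)
                  : realification X)
        (at_point 0) (Rbar_locally p_infty) (J : realification X) /\
      resolvent (A n) lam x = scal (RtoC lam : C_AbsRing) J.

Definition seq_dom (A : nat -> closed_operator) (x : nat -> X) : Prop :=
  moderate x /\ (forall n, dom (A n) (x n)) /\ moderate (fun n => A n (x n)).

Definition seq_range (A : nat -> closed_operator) (lam : R) (x : nat -> X)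
  : Prop :=
  moderate x /\
  exists y : nat -> X, moderate y /\ forall n, resolvent (A n) lam (y n) = x n.

Definition sim_op (A B : nat -> closed_operator) : Prop :=
  (exists D : X -> Prop,
     forall n x, (dom (A n) x <-> D x) /\ (dom (B n) x <-> D x)) /\
  (forall x, seq_dom A x <-> seq_dom B x) /\
  (forall x, seq_dom A x ->
     filterlim (fun n => minus (A n (x n)) (B n (x n)))
       eventually (locally (zero : X))).

Definition sim0_op (omega : R) (A B : nat -> closed_operator) : Prop :=
  sim_op A B /\
  exists b : R, 0 < b /\ forall x : nat -> X, moderate x ->
    tends_to_0 (fun n =>
      sup_over (half_plane omega) (fun lam =>
        norm (scal (Cpower lam b : C_AbsRing)
                (minus (resolvent (A n) lam (x n))
                       (resolvent (B n) lam (x n)))))).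

(** The relation between [S] and [T] also constrains the ranges of the
    resolvents of their generators [A] and [B]. *)
Definition sim_semigroup (omega : R) (A B : nat -> closed_operator)
  (S T : nat -> R -> X -> X) : Prop :=
  (forall x : nat -> X, moderate x ->
     I_exp (fun n t => minus (S n t (x n)) (T n t (x n)))) /\
  (forall lam : R, omega < lam ->
     (exists Rg : X -> Prop, forall n x,
        (Rg x <-> exists y, resolvent (A n) lam y = x) /\
        (Rg x <-> exists y, resolvent (B n) lam y = x)) /\
     (forall x, seq_range A lam x <-> seq_range B lam x)).

End Operators.

(* Main.v *)
Require Import Defs.
From Stdlib Require Import Reals Lra Lia List.
From Coquelicot Require Import Coquelicot.

Set Implicit Arguments.
Unset Strict Implicit.
Unset Printing Implicit Defensive.

Open Scope R_scope.

(** For [u = S_n(.)x] and [W = int_0^. u], injectivity of the real Laplace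
    transform turns [R(lam) x = lam int e^(-lam t) u] (known for large real
    [lam]) into [W(t) = R(mu)(t x + mu W(t) - u(t))], i.e. [A W(t) = u(t) - t x].
    Hence [W(t) = R(lam)(lam W(t) - u(t) + t x)] for every complex [lam] in the
    resolvent set, which gives [lam e^(-lam t) u(t)] an explicit primitive, and
    [R(lam) x = lam int e^(-lam t) u] on a whole half-plane.  So on a vertical
    line the Laplace transform of [(S_n - St_n) x_n] is
    [(R(lam, A_n) - R(lam, At_n)) x_n / lam], which (GE4) bounds by
    [eps_n |lam|^(-1-b)]; this is integrable, and Fourier inversion bounds
    [e^(-c t) (S_n - St_n)(t) x_n] by a constant times [eps_n].

    Both the injectivity and the inversion are proved with explicit approximate
    identities (a Landau kernel in [e^(-s)], and a Fejer kernel of period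
    [2 pi p] and order [p^2], [p -> oo]), whose integrals against a function
    are finite combinations of values of its Laplace transform. *)

(** * Improper integrals and approximate identities *)

(** The two hypotheses live in different places: generation speaks of large real [lam], (GE4) of a
    complex half-plane. They are joined by algebra alone: once [A W(t)] is known, the equation can
    be solved again with any other spectral parameter, so no analytic continuation enters. The
    primitive [W] is used because [u] itself need neither lie in the domain nor be differentiable.
    No integral along the vertical line is formed either. The Fejer kernel sees only the frequencies
    [k / p], where the decay [(1 + k / p)^(-1-b)] is summed by comparison with an integral. Its
    order must outgrow its period: the peak has width of order [1 / p], while the periodic copies of
    the peak move off to infinity, where the factor [exp (- s)] damps them. The error of the
    approximation depends on a modulus of continuity, which is uniform neither in [n] nor in [t]. It
    disappears because [p] tends to infinity with [n] and [t] fixed; what remains is a multiple of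
    [eps_n] whose constant depends on [b] only, once [exp (c t)] is split off. *)

Lemma ex_RInt_cont (E : CompleteNormedModule R_AbsRing) (f : R -> E) (a b : R) :
  (forall s, continuous f s) -> ex_RInt f a b.
Proof. now intros H; apply ex_RInt_continuous; intros; apply H. Qed.

Lemma is_RInt_cont (E : CompleteNormedModule R_AbsRing) (f : R -> E) (a b : R) :
  (forall s, continuous f s) -> is_RInt f a b (RInt f a b).
Proof. now intros H; apply (@RInt_correct E), ex_RInt_cont. Qed.

(** A bound on the upper limit of the norms of the truncated integrals. Convergence is not demanded,
    so such bounds add up over finite combinations; [int_le f 0] says that the integral converges to
    zero. *)
Definition int_le (E : CompleteNormedModule R_AbsRing) (f : R -> E) (d : R) : Prop :=
  forall eps : R, 0 < eps ->
    Rbar_locally p_infty (fun T => norm (RInt f 0 T) <= d + eps).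

Lemma int_le_plus (E : CompleteNormedModule R_AbsRing) (f g : R -> E) (d e : R) :
  (forall s, continuous f s) -> (forall s, continuous g s) ->
  int_le f d -> int_le g e -> int_le (fun s => plus (f s) (g s)) (d + e).
Proof.
intros cf cg Hf Hg eps He.
destruct (Hf (eps / 2)) as [M1 H1]; [lra|].
destruct (Hg (eps / 2)) as [M2 H2]; [lra|].
exists (Rmax M1 M2); intros T HT.
pose proof (Rmax_l M1 M2); pose proof (Rmax_r M1 M2).
rewrite (@RInt_plus E) by now apply ex_RInt_cont.
apply Rle_trans with (1 := @norm_triangle R_AbsRing E _ _).
specialize (H1 T); specialize (H2 T); lra.
Qed.

Lemma int_le_scal (E : CompleteNormedModule R_AbsRing) (k : R) (f : R -> E) (d : R) :
  (forall s, continuous f s) ->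
  int_le f d -> int_le (fun s => scal k (f s)) (Rabs k * d).
Proof.
intros cf Hf eps He.
pose proof (Rabs_pos k).
destruct (Hf (eps / (Rabs k + 1))) as [M H1]; [apply Rdiv_lt_0_compat; lra|].
exists M; intros T HT.
rewrite (@RInt_scal E) by now apply ex_RInt_cont.
apply Rle_trans with (1 := @norm_scal R_AbsRing E _ _).
specialize (H1 T HT).
apply Rle_trans with (Rabs k * (d + eps / (Rabs k + 1))).
- now apply Rmult_le_compat_l.
- rewrite Rmult_plus_distr_l; apply Rplus_le_compat_l.
  apply Rmult_le_reg_r with (Rabs k + 1); [lra|].
  replace (Rabs k * (eps / (Rabs k + 1)) * (Rabs k + 1)) with (Rabs k * eps)
    by (field; lra).
  nra.
Qed.

Lemma int_le_ext (E : CompleteNormedModule R_AbsRing) (f g : R -> E) (d : R) :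
  (forall s, 0 < s -> f s = g s) -> int_le f d -> int_le g d.
Proof.
intros H Hf eps He; destruct (Hf eps He) as [M H1].
exists (Rmax 0 M); intros T HT.
pose proof (Rmax_l 0 M); pose proof (Rmax_r 0 M).
rewrite (@RInt_ext E g f).
- apply H1; lra.
- intros s; rewrite Rmin_left by lra; intros Hs; symmetry; apply H; lra.
Qed.

Lemma int_le_mono (E : CompleteNormedModule R_AbsRing) (f : R -> E) (d e : R) :
  d <= e -> int_le f d -> int_le f e.
Proof.
intros H Hf eps He; destruct (Hf eps He) as [M H1].
exists M; intros T HT; specialize (H1 T HT); lra.
Qed.

Lemma int_le_zero (E : CompleteNormedModule R_AbsRing) (f : R -> E) :
  (forall s, 0 < s -> f s = zero) -> int_le f 0.
Proof.
intros H; apply (@int_le_ext E (fun _ => zero)); [now intros; rewrite H|].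
intros eps He; exists 0; intros T HT.
rewrite (@RInt_const E).
replace (norm _) with 0; [lra|].
rewrite <- (@norm_zero R_AbsRing E); f_equal; symmetry; apply (@scal_zero_r R_Ring E).
Qed.

(* The squared distance is measured in the coordinate [exp (- s)], which stays
   bounded on the half-line. *)
Lemma approximate_identity (E : CompleteNormedModule R_AbsRing) (f : R -> E)
  (rho : R -> R) (t T eta K a b d : R) :
  (forall s, continuous f s) -> (forall s, continuous rho s) ->
  0 <= T -> 0 <= K -> 0 <= a -> 0 <= b -> 0 <= d ->
  (forall s, 0 <= s -> 0 <= rho s) ->
  (forall s, 0 <= s ->
     norm (minus (f s) (f t)) <= eta + K * (exp (- s) - exp (- t)) ^ 2) ->
  a <= RInt rho 0 T ->
  RInt (fun s => rho s * (exp (- s) - exp (- t)) ^ 2) 0 T <= b ->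
  norm (RInt (fun s => scal (rho s) (f s)) 0 T) <= d ->
  a * (norm (f t) - eta) <= d + K * b.
Proof.
intros cf cr HT HK Ha0 Hb0 Hd0 Hr Hf Ha Hb Hd.
set (A := RInt rho 0 T) in *.
assert (cx : forall s, continuous (fun s => (exp (- s) - exp (- t)) ^ 2) s).
{ intros s; apply (ex_derive_continuous (fun s => (exp (- s) - exp (- t)) ^ 2)).
  auto_derive; trivial. }
assert (cxr : forall s, continuous (fun s => rho s * (exp (- s) - exp (- t)) ^ 2) s).
{ intros s; apply (continuous_mult rho (fun s => (exp (- s) - exp (- t)) ^ 2)); auto. }
assert (HA0 : 0 <= A).
{ apply RInt_ge_0; [easy|now apply (@ex_RInt_cont R_CompleteNormedModule)|].
  intros s Hs; apply Hr; lra. }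
assert (I1 : is_RInt (fun s => scal (rho s) (f s)) 0 T
               (RInt (fun s => scal (rho s) (f s)) 0 T)).
{ apply is_RInt_cont; intros s; apply (continuous_scal rho f); auto. }
(* The integral of a scalar function times a fixed vector is read off the primitive
   [scal (P u) (f t)]. *)
assert (I2 : is_RInt (fun s => scal (rho s) (f t)) 0 T (scal A (f t))).
{ pose (P := fun u => RInt rho 0 u).
  assert (E2 : scal A (f t) = minus (scal (P T) (f t)) (scal (P 0) (f t))).
  { unfold P; rewrite RInt_point.
    transitivity (minus (scal A (f t)) zero).
    - symmetry; apply (@minus_zero_r E).
    - f_equal; symmetry; apply (@scal_zero_l R_Ring E). }
  rewrite E2.
  apply (@is_RInt_derive E (fun u => scal (P u) (f t)) (fun u => scal (rho u) (f t))).
  - intros u _; apply (@is_derive_scal_l R_AbsRing E P u (rho u) (f t)).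
    apply (@is_derive_RInt _ rho P 0); [|apply cr].
    apply filter_forall; intros v; now apply is_RInt_cont.
  - intros u _; now apply (@continuous_scal_l R_UniformSpace R_AbsRing E rho). }
pose proof (is_RInt_minus _ _ _ _ _ _ I1 I2) as I3.
assert (I4 : is_RInt (fun s => eta * rho s + K * (rho s * (exp (- s) - exp (- t)) ^ 2))
   0 T (eta * A + K * RInt (fun s => rho s * (exp (- s) - exp (- t)) ^ 2) 0 T)).
{ apply (is_RInt_plus (V := R_NormedModule));
   apply (is_RInt_scal (V := R_NormedModule));
   now apply (@is_RInt_cont R_CompleteNormedModule). }
assert (B : norm (minus (RInt (fun s => scal (rho s) (f s)) 0 T) (scal A (f t)))
   <= eta * A + K * RInt (fun s => rho s * (exp (- s) - exp (- t)) ^ 2) 0 T).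
{ refine (@norm_RInt_le E _ _ 0 T _ _ HT _ I3 I4).
  intros s Hs.
  apply Rle_trans with (norm (scal (rho s) (minus (f s) (f t)))).
  { apply Req_le; f_equal; symmetry; apply (@scal_minus_distr_l R_Ring E). }
  apply Rle_trans with (1 := @norm_scal R_AbsRing E _ _).
  change (abs (rho s)) with (Rabs (rho s)); rewrite Rabs_pos_eq by (apply Hr; lra).
  replace (eta * rho s + _) with (rho s * (eta + K * (exp (- s) - exp (- t)) ^ 2)) by ring.
  apply Rmult_le_compat_l; [apply Hr; lra|apply Hf; lra]. }
assert (N : A * norm (f t) <= norm (scal A (f t))).
{ destruct (Req_dec A 0) as [->|HA]; [rewrite Rmult_0_l; apply norm_ge_0|].
  apply Rmult_le_reg_l with (/ A); [apply Rinv_0_lt_compat; lra|].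
  rewrite <- Rmult_assoc, Rinv_l, Rmult_1_l by lra.
  apply Rle_trans with (norm (scal (/ A) (scal A (f t)))).
  - apply Req_le; f_equal; rewrite (@scal_assoc R_Ring E).
    change (f t = scal (/ A * A) (f t)).
    rewrite Rinv_l by lra; symmetry; apply (@scal_one R_Ring E).
  - apply Rle_trans with (1 := @norm_scal R_AbsRing E _ _).
    apply Req_le; f_equal; change (Rabs (/ A) = / A); apply Rabs_pos_eq.
    left; apply Rinv_0_lt_compat; lra. }
assert (Q : norm (scal A (f t)) <= d + (eta * A + K * b)).
{ set (v := scal A (f t)) in *; set (J := RInt (fun s => scal (rho s) (f s)) 0 T) in *.
  apply Rle_trans with (norm (minus J (minus J v))).
  - apply Req_le; f_equal; symmetry; unfold minus.
    rewrite (@opp_plus E), (@opp_opp E), (@plus_assoc E), (@plus_opp_r E).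
    apply (@plus_zero_l E).
  - apply Rle_trans with (1 := @norm_triangle R_AbsRing E _ _).
    rewrite (@norm_opp R_AbsRing E); apply Rplus_le_compat; [easy|].
    apply Rle_trans with (1 := B); apply Rplus_le_compat_l.
    now apply Rmult_le_compat_l. }
assert (0 <= K * b) by now apply Rmult_le_pos.
(* Replacing the mass [A] by its lower bound [a] needs [norm (f t) - eta] to be nonnegative;
   otherwise the left side is at most 0. *)
destruct (Rle_dec (norm (f t)) eta).
- assert (0 <= a * (eta - norm (f t))) by (apply Rmult_le_pos; lra); lra.
- apply Rle_trans with (A * (norm (f t) - eta)); [|lra].
  apply Rmult_le_compat_r; lra.
Qed.

(** Near [t] continuity gives [eta]. Away from [t] the points [exp (- s)] and [exp (- t)] are at
    least [c] apart, by monotonicity, so that the quadratic term with [K = 2 B / c^2] absorbs the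
    crude bound [2 B]. *)
Lemma exp_modulus (E : NormedModule R_AbsRing) (f : R -> E) (B t eta : R) :
  continuous f t -> 0 <= t -> 0 < eta -> 0 <= B ->
  (forall s, 0 <= s -> norm (f s) <= B) ->
  exists K, 0 <= K /\ forall s, 0 <= s ->
     norm (minus (f s) (f t)) <= eta + K * (exp (- s) - exp (- t)) ^ 2.
Proof.
intros cf Ht Heta HB Hf.
pose proof (@norm_factor_gt_0 R_AbsRing E) as Hnf.
(* A ball of radius [r] controls the norm only up to the factor [norm_factor], hence the
   division. *)
assert (He : 0 < eta / @norm_factor R_AbsRing E) by now apply Rdiv_lt_0_compat.
destruct (cf (ball (f t) (mkposreal _ He)) (locally_ball _ _)) as [del Hdel].
assert (Hnear : forall s, Rabs (s - t) < del -> norm (minus (f s) (f t)) <= eta).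
{ intros s Hs; left.
  replace eta with (@norm_factor R_AbsRing E * mkposreal _ He) by (simpl; field; lra).
  apply norm_compat2, Hdel, Hs. }
assert (Hd := cond_pos del).
pose (c := Rmin (exp (- t) - exp (- (t + del))) (exp (- (t - del)) - exp (- t))).
assert (Hc : 0 < c).
{ apply Rmin_glb_lt; apply Rlt_0_minus, exp_increasing; lra. }
assert (HK : 0 <= 2 * B / c ^ 2).
{ apply Rmult_le_pos; [lra|]; left; apply Rinv_0_lt_compat; nra. }
exists (2 * B / c ^ 2); split; [easy|].
intros s Hs.
destruct (Rlt_dec (Rabs (s - t)) del) as [Hst|Hst].
- apply Rle_trans with (1 := Hnear _ Hst).
  pose proof (pow2_ge_0 (exp (- s) - exp (- t))); nra.
- assert (Hfar : c ^ 2 <= (exp (- s) - exp (- t)) ^ 2).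
  { rewrite <- (pow2_abs (exp (- s) - exp (- t))); apply pow_incr; split; [lra|].
    apply Rnot_lt_le in Hst; revert Hst; unfold Rabs at 1; destruct Rcase_abs as [Hn|Hn].
    - intros Hst; apply Rle_trans with (1 := Rmin_r _ _).
      apply Rle_trans with (2 := Rle_abs _).
      apply Rplus_le_compat_r; destruct (Req_dec s (t - del)) as [->|]; [lra|].
      left; apply exp_increasing; lra.
    - intros Hst; apply Rle_trans with (1 := Rmin_l _ _).
      rewrite Rabs_minus_sym; apply Rle_trans with (2 := Rle_abs _).
      apply Rplus_le_compat_l, Ropp_le_contravar.
      destruct (Req_dec s (t + del)) as [->|]; [lra|].
      left; apply exp_increasing; lra. }
  apply Rle_trans with (2 * B).
  + unfold minus; apply Rle_trans with (1 := norm_triangle _ _).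
    rewrite norm_opp; specialize (Hf s Hs) as H1; specialize (Hf t Ht) as H2; lra.
  + apply Rle_trans with (2 * B / c ^ 2 * c ^ 2).
    * right; field; lra.
    * assert (2 * B / c ^ 2 * c ^ 2 <= 2 * B / c ^ 2 * (exp (- s) - exp (- t)) ^ 2).
      { now apply Rmult_le_compat_l. }
      lra.
Qed.

(** * Injectivity of the Laplace transform *)

Lemma Rbernoulli (x : R) (n : nat) : 0 <= x <= 1 -> 1 - INR n * x <= (1 - x) ^ n.
Proof.
intros Hx; induction n as [|n IH]; [simpl; lra|].
rewrite S_INR; simpl.
assert (0 <= (1 - x) ^ n) by (apply pow_le; lra).
pose proof (pos_INR n); nra.
Qed.

(** Induction works since [(1 - x) (1 + (n + 1) x) = 1 + n x - (n + 1) x^2]. The consequence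
    [(1 - x)^n x <= 1 / n] is the second-moment bound of the Landau kernel. *)
Lemma pow_one_minus_le (x : R) (n : nat) : 0 <= x <= 1 ->
  (1 - x) ^ n * (1 + INR n * x) <= 1.
Proof.
intros Hx; induction n as [|n IH]; [simpl; lra|].
rewrite S_INR; simpl.
assert (0 <= (1 - x) ^ n) by (apply pow_le; lra).
pose proof (pos_INR n).
apply Rle_trans with (2 := IH).
replace ((1 - x) * (1 - x) ^ n * (1 + (INR n + 1) * x)) with
  ((1 - x) ^ n * ((1 - x) * (1 + (INR n + 1) * x))) by ring.
apply Rmult_le_compat_l; [easy|nra].
Qed.

Lemma exp_lipschitz (s t : R) : 0 <= s -> 0 <= t -> 
  Rabs (exp (- s) - exp (- t)) <= Rabs (s - t).
Proof.
assert (W : forall a b, 0 <= a <= b -> 0 <= exp (- a) - exp (- b) <= b - a).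
{ intros a b [Ha Hab]; pose proof (exp_pos (- a)); pose proof (exp_pos (- b)).
  assert (E1 : exp (- b) = exp (- a) * exp (a - b)) by (rewrite <- exp_plus; f_equal; ring).
  pose proof (exp_ineq1_le (a - b)); pose proof (exp_ineq1_le a).
  assert (exp (- a) * exp a = 1) by (rewrite <- exp_plus, <- exp_0; f_equal; ring).
  assert (exp (- a) <= 1) by nra.
  assert (exp (a - b) <= 1).
  { destruct (Req_dec a b) as [->|]; [rewrite Rminus_diag, exp_0; lra|].
    rewrite <- exp_0; left; apply exp_increasing; lra. }
  rewrite E1; nra. }
intros Hs Ht; destruct (Rle_dec s t).
- destruct (W s t); [lra|].
  rewrite (Rabs_minus_sym s), !Rabs_pos_eq; lra.
- destruct (W t s); [lra|].
  rewrite (Rabs_minus_sym (exp (- s))), !Rabs_pos_eq; lra.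
Qed.

Lemma RInt_exp_le (k c T : R) : 0 < k -> 0 <= T -> 0 <= c ->
  RInt (fun s => c * exp (- (k * s))) 0 T <= c / k.
Proof.
intros Hk HT Hc.
assert (H : is_RInt (fun s => c * exp (- (k * s))) 0 T
  (minus (- (c / k) * exp (- (k * T))) (- (c / k) * exp (- (k * 0))))).
{ apply (@is_RInt_derive R_CompleteNormedModule (fun s => - (c / k) * exp (- (k * s)))
           (fun s => c * exp (- (k * s)))).
  - intros s _; auto_derive; trivial; field; lra.
  - intros s _; apply (ex_derive_continuous (fun s => c * exp (- (k * s)))).
    auto_derive; trivial. }
rewrite (is_RInt_unique _ _ _ _ H); unfold minus, plus, opp; simpl.
rewrite Rmult_0_r, Ropp_0, exp_0.
pose proof (exp_pos (- (k * T))).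
assert (0 <= c / k) by (apply Rmult_le_pos; [lra|left; now apply Rinv_0_lt_compat]).
nra.
Qed.

Lemma RInt_lower (g : R -> R) (m u v T : R) :
  (forall s, continuous g s) -> (forall s, 0 <= s -> 0 <= g s) ->
  0 <= u <= v -> v <= T -> (forall s, u <= s <= v -> m <= g s) ->
  m * (v - u) <= RInt g 0 T.
Proof.
intros cg Hg Huv HvT Hm.
assert (X : forall a b, ex_RInt g a b) by (intros; now apply (@ex_RInt_cont R_CompleteNormedModule)).
assert (P : forall a b, 0 <= a <= b -> 0 <= RInt g a b).
{ intros a b Hab; apply RInt_ge_0; [lra|apply X|]; intros s Hs; apply Hg; lra. }
rewrite <- (@RInt_Chasles R_CompleteNormedModule g 0 v T), <- (@RInt_Chasles R_CompleteNormedModule g 0 u v) by apply X.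
unfold plus; simpl.
pose proof (P 0 u); pose proof (P v T).
assert (m * (v - u) <= RInt g u v).
{ assert (EE : RInt (fun _ => m) u v = m * (v - u)).
  { rewrite (@RInt_const R_CompleteNormedModule); unfold scal; simpl; unfold mult; simpl; ring. }
  rewrite <- EE; apply RInt_le; [lra|apply ex_RInt_const|apply X|].
  intros s Hs; apply Hm; lra. }
lra.
Qed.

(** The factor [1 - (exp (- s) - y0)^2] is a quadratic polynomial in [exp (- s)], and multiplication
    by [exp (- s)] only shifts [l] to [l + 1]. The range [l > l1] is stable under such shifts, so
    [l] has to stay general in the induction on [N]. *)
Lemma laplace_poly (E : CompleteNormedModule R_AbsRing) (f : R -> E) (l1 y0 : R) :
  (forall s, continuous f s) ->
  (forall l, l1 < l -> int_le (fun s => scal (exp (- (l * s))) (f s)) 0) ->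
  forall N l, l1 < l ->
   int_le (fun s => scal (exp (- (l * s)) * (1 - (exp (- s) - y0) ^ 2) ^ N) (f s)) 0.
Proof.
intros cf Hf N; induction N as [|N IH]; intros l Hl.
{ apply (@int_le_ext E (fun s => scal (exp (- (l * s))) (f s))); [|now apply Hf].
  intros s _; simpl; now rewrite Rmult_1_r. }
pose (F := fun l s => scal (exp (- (l * s)) * (1 - (exp (- s) - y0) ^ 2) ^ N) (f s)).
assert (cF : forall l s, continuous (F l) s).
{ intros l' s; apply (@continuous_scal R_UniformSpace R_AbsRing E
     (fun s => exp (- (l' * s)) * (1 - (exp (- s) - y0) ^ 2) ^ N)); [|apply cf].
  apply (ex_derive_continuous (fun s => exp (- (l' * s)) * (1 - (exp (- s) - y0) ^ 2) ^ N)).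
  auto_derive; trivial. }
assert (cS : forall k l s, continuous (fun s => scal k (F l s)) s).
{ intros k l' s; apply (@continuous_scal_r R_UniformSpace R_AbsRing E k (F l')), cF. }
apply (@int_le_ext E (fun s => plus (plus (scal (1 - y0 ^ 2) (F l s))
   (scal (2 * y0) (F (l + 1) s))) (scal (- 1) (F (l + 2) s)))).
- intros s _; unfold F.
  rewrite !(@scal_assoc R_Ring E), <- !(@scal_distr_r R_Ring E); f_equal.
  unfold mult, plus; simpl; unfold mult, plus; simpl.
  replace (- ((l + 1) * s)) with (- (l * s) + - s) by ring.
  replace (- ((l + 2) * s)) with (- (l * s) + (- s + - s)) by ring.
  rewrite !exp_plus; ring.
- apply int_le_mono with (Rabs (1 - y0 ^ 2) * 0 + Rabs (2 * y0) * 0 + Rabs (- 1) * 0); [lra|].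
  apply int_le_plus; [intros s; apply (@continuous_plus R_UniformSpace R_AbsRing E); apply cS
    |apply cS| |].
  apply int_le_plus; [apply cS|apply cS| |].
  all: apply int_le_scal; [apply cF|apply IH; lra].
Qed.

(** The form in which the parameter [p] of both kernels is sent to infinity. *)
Lemma le_epsilon_seq (x C : R) :
  (forall p : nat, (0 < p)%nat -> x <= C / INR p) -> x <= 0.
Proof.
intros H; apply Rnot_lt_le; intros Hx.
destruct (archimed_cor1 (x / (Rabs C + 1))) as [p [Hp Hp0]].
{ pose proof (Rabs_pos C); apply Rdiv_lt_0_compat; lra. }
specialize (H p Hp0).
assert (0 < INR p) by now apply lt_0_INR.
pose proof (Rle_abs C); pose proof (Rabs_pos C).
assert (/ INR p * (Rabs C + 1) < x).
{ apply Rmult_lt_compat_r with (r := Rabs C + 1) in Hp; [|lra].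
  unfold Rdiv in Hp; rewrite Rmult_assoc, Rinv_l in Hp by lra; lra. }
assert (0 < / INR p) by now apply Rinv_0_lt_compat.
unfold Rdiv in H; nra.
Qed.

(** The Landau kernel [rho] integrates to zero against [f] by [laplace_poly]. Its mass is at least
    of order [1 / p] and its second moment at most of order [1 / p^2], so the error [K b / a] is of
    order [1 / p]. *)
Lemma laplace_injective (E : CompleteNormedModule R_AbsRing) (f : R -> E) (B l1 t : R) :
  (forall s, continuous f s) ->  0 <= B ->
  (forall s, 0 <= s -> norm (f s) <= B) ->
  (forall l, l1 < l -> int_le (fun s => scal (exp (- (l * s))) (f s)) 0) ->
  0 <= t -> f t = zero.
Proof.
intros cf HB Hf HL Ht.
apply (@norm_eq_zero R_AbsRing E), Rle_antisym; [|apply norm_ge_0].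
apply le_epsilon; intros eta Heta; rewrite Rplus_0_l.
destruct (@exp_modulus E f B t eta) as [K [HK Hmod]]; auto.
(* Besides exceeding [l1], [l >= 1] makes the integral of [exp (- l s)] at most 1. *)
pose (l := Rmax 1 (l1 + 1)).
assert (Hl1 : 1 <= l) by apply Rmax_l.
assert (Hl2 : l1 < l) by (assert (l1 + 1 <= l) by apply Rmax_r; lra).
enough (Z : norm (f t) - eta <= 0) by lra.
apply le_epsilon_seq with (C := 4 * K * exp (l * (t + 1))).
intros p Hp.
assert (Hp1 : 1 <= INR p) by (change 1 with (INR 1); apply le_INR; lia).
(* Chosen so that [N (1 / (2 p))^2 = 1 / 2]: by Bernoulli the power in [rho] is at least [1 / 2] on
   [[t, t + 1 / (2 p)]]. *)
pose (N := (2 * p * p)%nat).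
assert (HN : INR N = 2 * INR p * INR p) by (unfold N; rewrite !mult_INR; simpl; ring).
set (rho := fun s => exp (- (l * s)) * (1 - (exp (- s) - exp (- t)) ^ 2) ^ N).
assert (Hx1 : forall s, 0 <= s -> 0 <= (exp (- s) - exp (- t)) ^ 2 <= 1).
{ intros s Hs; split; [apply pow2_ge_0|].
  assert (Z : forall u, 0 <= u -> 0 < exp (- u) <= 1).
  { intros u Hu; split; [apply exp_pos|]; rewrite <- exp_0.
    destruct (Req_dec u 0) as [->|]; [rewrite Ropp_0; lra|left; apply exp_increasing; lra]. }
  pose proof (Z s Hs); pose proof (Z t Ht); nra. }
assert (Hrho : forall s, 0 <= s -> 0 <= rho s).
{ intros s Hs; apply Rmult_le_pos; [left; apply exp_pos|apply pow_le].
  specialize (Hx1 s Hs); lra. }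
assert (cr : forall s, continuous rho s).
{ intros s; apply (ex_derive_continuous rho); unfold rho; auto_derive; trivial. }
(* The lower bound [1 / 2 * exp (- l (t + 1))] of [rho] times the length [1 / (2 p)] of that
   interval. *)
pose (a := / (4 * INR p) * exp (- (l * (t + 1)))).
pose (b := / INR N).
assert (Ha : 0 < a).
{ apply Rmult_lt_0_compat; [apply Rinv_0_lt_compat; lra|apply exp_pos]. }
assert (HN0 : 0 < INR N) by (rewrite HN; nra).
assert (Hb : 0 < b) by now apply Rinv_0_lt_compat.
assert (Hd : forall d, 0 < d -> a * (norm (f t) - eta) <= d + K * b).
{ intros d Hd.
  destruct (@laplace_poly E f l1 (exp (- t)) cf HL N l Hl2 d Hd) as [M HM].
  (* The truncation passes the threshold [M] and contains the interval that carries the mass. *)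
  pose (T := Rmax (M + 1) (t + 1)).
  assert (HT1 : M < T) by (assert (M + 1 <= T) by apply Rmax_l; lra).
  assert (HT2 : t + 1 <= T) by apply Rmax_r.
  specialize (HM T HT1); rewrite Rplus_0_l in HM.
  apply (@approximate_identity E f rho t T eta K a b d); auto; try lra.
  - replace a with (exp (- (l * (t + 1))) * (1 / 2) * ((t + / (2 * INR p)) - t))
      by (unfold a; field; lra).
    assert (/ (2 * INR p) <= 1).
    { rewrite <- Rinv_1; apply Rinv_le_contravar; lra. }
    assert (0 < / (2 * INR p)) by (apply Rinv_0_lt_compat; lra).
    apply RInt_lower; auto; try lra.
    intros s Hs; unfold rho; apply Rmult_le_compat; [left; apply exp_pos|lra| |].
    + assert (l * s <= l * (t + 1)) by (apply Rmult_le_compat_l; lra).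
      destruct (Req_dec (l * s) (l * (t + 1))) as [->|]; [lra|left; apply exp_increasing; lra].
    + apply Rle_trans with (2 := @Rbernoulli _ N (Hx1 s ltac:(lra))).
      assert ((exp (- s) - exp (- t)) ^ 2 <= (/ (2 * INR p)) ^ 2).
      { rewrite <- pow2_abs; apply pow_incr; split; [apply Rabs_pos|].
        apply Rle_trans with (1 := @exp_lipschitz s t ltac:(lra) Ht).
        rewrite Rabs_pos_eq; lra. }
      assert (INR N * (/ (2 * INR p)) ^ 2 = 1 / 2) by (rewrite HN; field; lra).
      assert (INR N * (exp (- s) - exp (- t)) ^ 2 <= INR N * (/ (2 * INR p)) ^ 2)
        by (apply Rmult_le_compat_l; lra).
      lra.
  - apply Rle_trans with (b / l).
    2:{ unfold Rdiv; rewrite <- (Rmult_1_r b) at 2; apply Rmult_le_compat_l; [lra|].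
        rewrite <- Rinv_1; apply Rinv_le_contravar; lra. }
    apply Rle_trans with (2 := @RInt_exp_le l b T ltac:(lra) ltac:(lra) ltac:(lra)).
    apply RInt_le; [lra| | |].
    + apply (@ex_RInt_cont R_CompleteNormedModule); intros s.
      apply (ex_derive_continuous (fun s => rho s * (exp (- s) - exp (- t)) ^ 2)).
      unfold rho; auto_derive; trivial.
    + apply (@ex_RInt_cont R_CompleteNormedModule); intros s.
      apply (ex_derive_continuous (fun s => b * exp (- (l * s)))); auto_derive; trivial.
    + intros s Hs; unfold rho.
      destruct (Hx1 s) as [X0 X1]; [lra|].
      set (z := (exp (- s) - exp (- t)) ^ 2) in *.
      assert (Y := @pow_one_minus_le z N (conj X0 X1)).
      assert (0 <= (1 - z) ^ N) by (apply pow_le; lra).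
      assert ((1 - z) ^ N * z <= b).
      { apply Rmult_le_reg_l with (INR N); [easy|]; unfold b; rewrite Rinv_r by lra; nra. }
      pose proof (exp_pos (- (l * s))); nra. }
assert (Hfin : a * (norm (f t) - eta) <= K * b) by (apply le_epsilon; intros d Hd'; rewrite Rplus_comm; auto).
apply Rmult_le_reg_l with a; [easy|].
apply Rle_trans with (1 := Hfin).
unfold a, b; rewrite HN.
assert (EE : exp (- (l * (t + 1))) * exp (l * (t + 1)) = 1)
  by (rewrite <- exp_plus, Rplus_opp_l; apply exp_0).
replace (/ (4 * INR p) * exp (- (l * (t + 1))) * (4 * K * exp (l * (t + 1)) / INR p))
  with (K / (INR p * INR p) * (exp (- (l * (t + 1))) * exp (l * (t + 1)))) by (field; lra).
rewrite EE.
replace (K * / (2 * INR p * INR p)) with (K / (INR p * INR p) * (1 / 2)) by (field; lra).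
apply Rmult_le_compat_l; [|lra].
apply Rmult_le_pos; [lra|left; apply Rinv_0_lt_compat; nra].
Qed.

(** * Inversion by the Fejer kernel *)

Fixpoint dirichlet (j : nat) (th : R) : R :=
  match j with
  | O => 1
  | S i => dirichlet i th + 2 * cos (INR (S i) * th)
  end.

(** The sum of the first [m] Dirichlet kernels without the usual factor [1 / m]; off the multiples
    of [2 pi] it equals [(1 - cos (m th)) / (1 - cos th)]. *)
Fixpoint fejer (m : nat) (th : R) : R :=
  match m with
  | O => 0
  | S i => fejer i th + dirichlet i th
  end.

(** Multiplying by [1 - cos th] instead of dividing keeps the multiples of [2 pi] from being
    exceptional. The right side telescopes once more when the Dirichlet kernels are summed. *)
Lemma dirichlet_closed (j : nat) (th : R) :
  (1 - cos th) * dirichlet j th = cos (INR j * th) - cos (INR (S j) * th).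
Proof.
induction j as [|j IH].
- simpl; rewrite Rmult_0_l, cos_0, Rmult_1_l; ring.
- cbn [dirichlet]; rewrite Rmult_plus_distr_l, IH.
  replace (INR j * th) with (INR (S j) * th - th) by (rewrite S_INR; ring).
  replace (INR (S (S j)) * th) with (INR (S j) * th + th) by (rewrite (S_INR (S j)); ring).
  rewrite cos_plus, cos_minus; ring.
Qed.

Lemma fejer_closed (m : nat) (th : R) :
  (1 - cos th) * fejer m th = 1 - cos (INR m * th).
Proof.
induction m as [|m IH].
- simpl; rewrite Rmult_0_l, cos_0; ring.
- cbn [fejer]; rewrite Rmult_plus_distr_l, IH, dirichlet_closed; ring.
Qed.

Lemma cos_mult_eq_1 (k : nat) (th : R) : cos th = 1 -> cos (INR k * th) = 1.
Proof.
intros H.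
assert (Hs : sin th = 0) by (pose proof (sin2_cos2 th); unfold Rsqr in *; nra).
induction k as [|k IH]; [now rewrite Rmult_0_l, cos_0|].
rewrite S_INR, Rmult_plus_distr_r, Rmult_1_l, cos_plus, IH, H, Hs; ring.
Qed.

Lemma dirichlet_ge (j : nat) (th c : R) :
  (forall k, (k <= j)%nat -> c <= cos (INR k * th)) ->
  1 + 2 * INR j * c <= dirichlet j th.
Proof.
induction j as [|j IH]; intros H; [simpl; lra|].
cbn [dirichlet]; specialize (IH (fun k hk => H k (Nat.le_trans _ _ _ hk (Nat.le_succ_diag_r j)))).
specialize (H (S j) (Nat.le_refl _)); revert H; rewrite S_INR; intros H; nra.
Qed.

(** As [c <= 1], each Dirichlet kernel is at least [(1 + 2 j) c], and the first [m] odd numbers add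
    up to [m^2]. This bounds the peak from below. *)
Lemma fejer_ge (m : nat) (th c : R) : 0 <= c <= 1 ->
  (forall k, (k <= m)%nat -> c <= cos (INR k * th)) ->
  INR m * INR m * c <= fejer m th.
Proof.
intros Hc; induction m as [|m IH]; intros H; [simpl; lra|].
cbn [fejer]; specialize (IH (fun k hk => H k (Nat.le_trans _ _ _ hk (Nat.le_succ_diag_r m)))).
assert (D := @dirichlet_ge m th c
  (fun k hk => H k (Nat.le_trans _ _ _ hk (Nat.le_succ_diag_r m)))).
rewrite S_INR; nra.
Qed.

(** The closed form decides the sign wherever [cos th <> 1]; at the remaining points all cosines
    equal 1 and [fejer_ge] applies with [c = 1]. *)
Lemma fejer_nonneg (m : nat) (th : R) : 0 <= fejer m th.
Proof.
destruct (Req_dec (cos th) 1) as [H|H].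
- apply Rle_trans with (INR m * INR m * 1); [pose proof (pos_INR m); nra|].
  apply fejer_ge; [lra|]; intros k _; rewrite cos_mult_eq_1; lra.
- assert (F := fejer_closed m th).
  pose proof (COS_bound th); pose proof (COS_bound (INR m * th)).
  apply Rmult_le_reg_l with (1 - cos th); [|lra].
  destruct (Rtotal_order (cos th) 1) as [|[|]]; [lra|contradiction|lra].
Qed.

Lemma fejer_le (m : nat) (th : R) : fejer m th <= INR m * INR m.
Proof.
assert (D : forall j, dirichlet j th <= 2 * INR j + 1).
{ induction j as [|j IH]; [simpl; lra|].
  cbn [dirichlet]; pose proof (COS_bound (INR (S j) * th)).
  assert (EE := S_INR j); lra. }
induction m as [|m IH]; [simpl; lra|].
cbn [fejer]; specialize (D m); rewrite S_INR; nra.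
Qed.

(** The Taylor polynomial of degree four gives [1 - cos x >= x^2 / 2 - x^4 / 24], which is at least
    [11 / 24 * x^2] on this interval; 5 is a convenient constant above [24 / 11]. *)
Lemma cos_le_quadratic (x : R) : -1 <= x <= 1 -> x ^ 2 <= 5 * (1 - cos x).
Proof.
intros Hx.
assert (Hpi := PI2_1).
destruct (cos_bound x 0) as [_ H]; [lra|lra|].
revert H; unfold cos_approx, cos_term; simpl; intros H.
assert (0 <= x * x <= 1) by nra.
assert (0 <= (x * x) * (1 - x * x)) by nra.
lra.
Qed.

Lemma cos_ge_half (x : R) : -1 <= x <= 1 -> 1 / 2 <= cos x.
Proof.
intros Hx; rewrite <- cos_PI3.
assert (Hpi := PI2_3_2); unfold PI2 in *.
destruct (Rle_dec 0 x).
- apply cos_decr_1; lra.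
- rewrite <- (cos_neg x); apply cos_decr_1; lra.
Qed.

(** [th^2] is at most [5 (1 - cos th)], and the closed form bounds [(1 - cos th) fejer m th] by 2,
    uniformly in [m]. *)
Lemma fejer_decay (m : nat) (th : R) : -1 <= th <= 1 -> fejer m th * th ^ 2 <= 10.
Proof.
intros H; assert (Q := cos_le_quadratic H).
assert (F := fejer_closed m th); assert (P := fejer_nonneg m th).
pose proof (COS_bound (INR m * th)); nra.
Qed.

(** * Summing the decay over the frequencies [k / p] *)

Lemma Rpower_base_1 (x : R) : Rpower 1 x = 1.
Proof. now unfold Rpower; rewrite ln_1, Rmult_0_r, exp_0. Qed.

(** Comparison with the integral of [x^(-1-b)] over [[a, c]], whose integrand is smallest at [c].
    After dividing by [c^(-b)] it becomes an inequality in [a / c] alone. *)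
Lemma Rpower_telescope (a c b : R) : 0 < a <= c -> 0 < b ->
  (c - a) * Rpower c (- (1 + b)) <= (Rpower a (- b) - Rpower c (- b)) / b.
Proof.
intros Hac Hb.
apply Rmult_le_reg_r with b; [easy|].
replace ((Rpower a (- b) - Rpower c (- b)) / b * b) with (Rpower a (- b) - Rpower c (- b))
  by (field; lra).
replace (- (1 + b)) with (- b + - (1)) by ring.
rewrite Rpower_plus, (Rpower_Ropp c 1), Rpower_1 by lra.
replace (Rpower a (- b)) with (Rpower c (- b) * Rpower (a / c) (- b)).
2:{ rewrite Rpower_mult_distr; [f_equal; field; lra|lra|apply Rdiv_lt_0_compat; lra]. }
(* Both [ln y <= y - 1] and [exp y >= 1 + y] are used, the former with [y = a / c]. *)
assert (L : 1 + b * (1 - a / c) <= Rpower (a / c) (- b)).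
{ unfold Rpower; apply Rle_trans with (2 := exp_ineq1_le _).
  assert (ln (a / c) <= a / c - 1).
  { assert (X := exp_ineq1_le (ln (a / c))); rewrite exp_ln in X; [lra|].
    apply Rdiv_lt_0_compat; lra. }
  nra. }
assert (P : 0 < Rpower c (- b)) by apply exp_pos.
replace ((c - a) * (Rpower c (- b) * / c) * b) with (Rpower c (- b) * (b * (1 - a / c)))
  by (field; lra).
nra.
Qed.

Fixpoint decay_sum (b p : R) (j : nat) : R :=
  match j with
  | O => 0
  | S i => decay_sum b p i + Rpower (1 + INR (S i) / p) (- (1 + b))
  end.

(** A Riemann sum of step [1 / p] for [p] times the integral of [x^(-1-b)] over [x > 1], which is
    [p / b] whatever [j] is. The induction needs the partial integral, kept in [H]. *)
Lemma decay_sum_le (b p : R) (j : nat) : 0 < b -> 0 < p -> decay_sum b p j <= p / b.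
Proof.
intros Hb Hp.
assert (H : decay_sum b p j <= p * ((1 - Rpower (1 + INR j / p) (- b)) / b)).
{ induction j as [|j IH].
  - simpl decay_sum; simpl INR; replace (1 + 0 / p) with 1 by (field; lra).
    rewrite Rpower_base_1; lra.
  - cbn [decay_sum].
    assert (T := @Rpower_telescope (1 + INR j / p) (1 + INR (S j) / p) b).
    rewrite S_INR in *.
    assert (0 <= INR j / p) by (apply Rmult_le_pos; [apply pos_INR|left; now apply Rinv_0_lt_compat]).
    assert (0 < / p) by now apply Rinv_0_lt_compat.
    replace ((INR j + 1) / p) with (INR j / p + / p) in * by (field; lra).
    specialize (T ltac:(lra) Hb).
    replace (1 + (INR j / p + / p) - (1 + INR j / p)) with (/ p) in T by ring.
    apply Rmult_le_compat_l with (r := p) in T; [|lra].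
    rewrite <- Rmult_assoc, Rinv_r, Rmult_1_l in T by lra.
    unfold Rdiv in *; nra. }
apply Rle_trans with (1 := H).
assert (0 < Rpower (1 + INR j / p) (- b)) by apply exp_pos.
unfold Rdiv; apply Rmult_le_compat_l; [lra|].
rewrite <- (Rmult_1_l (/ b)) at 2; apply Rmult_le_compat_r; [left; now apply Rinv_0_lt_compat|lra].
Qed.

Lemma ex_derive_dirichlet (j : nat) (th : R) : ex_derive (dirichlet j) th.
Proof.
induction j as [|j IH]; [apply ex_derive_const|].
apply (@ex_derive_plus R_AbsRing R_NormedModule (dirichlet j)); [easy|].
auto_derive; trivial.
Qed.

Lemma ex_derive_fejer (m : nat) (th : R) : ex_derive (fejer m) th.
Proof.
induction m as [|m IH]; [apply ex_derive_const|].
apply (@ex_derive_plus R_AbsRing R_NormedModule (fejer m)); [easy|].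
apply ex_derive_dirichlet.
Qed.

Lemma continuous_kernel (g : R -> R) (t p s : R) : (forall th, ex_derive g th) ->
  continuous (fun s => g ((s - t) / p) * exp (- s)) s.
Proof.
intros Hg; apply (ex_derive_continuous (fun s => g ((s - t) / p) * exp (- s))).
auto_derive; apply Hg.
Qed.

(** Every Dirichlet kernel contributes the frequency 0 once and each [k / p] twice; by
    [decay_sum_le] its bound does not depend on its order, and [m] of them are added. *)
Lemma fejer_int_le (E : CompleteNormedModule R_AbsRing) (f : R -> E) (t b eps p : R) (m : nat) :
  (forall s, continuous f s) -> 0 < b -> 0 <= eps -> 0 < p ->
  (forall sg, 0 <= sg -> int_le (fun s => scal (cos (sg * (s - t)) * exp (- s)) (f s))
     (eps * Rpower (1 + sg) (- (1 + b)))) ->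
  int_le (fun s => scal (fejer m ((s - t) / p) * exp (- s)) (f s))
    (INR m * (eps * (1 + 2 * (p / b)))).
Proof.
intros cf Hb Heps Hp H.
assert (cD : forall j s, continuous (fun s => scal (dirichlet j ((s - t) / p) * exp (- s)) (f s)) s).
{ intros j s; apply (@continuous_scal R_UniformSpace R_AbsRing E
     (fun s => dirichlet j ((s - t) / p) * exp (- s))); [|apply cf].
  apply continuous_kernel, ex_derive_dirichlet. }
assert (cF : forall j s, continuous (fun s => scal (fejer j ((s - t) / p) * exp (- s)) (f s)) s).
{ intros j s; apply (@continuous_scal R_UniformSpace R_AbsRing E
     (fun s => fejer j ((s - t) / p) * exp (- s))); [|apply cf].
  apply continuous_kernel, ex_derive_fejer. }
assert (HD : forall j, int_le (fun s => scal (dirichlet j ((s - t) / p) * exp (- s)) (f s))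
    (eps * (1 + 2 * decay_sum b p j))).
{ induction j as [|j IH].
  - apply int_le_ext with (f := fun s => scal (cos (0 * (s - t)) * exp (- s)) (f s)).
    { intros s _; simpl; now rewrite Rmult_0_l, cos_0. }
    apply (fun h => @int_le_mono E _ _ _ h (H 0 (Rle_refl 0))).
    rewrite Rplus_0_r, Rpower_base_1; simpl; lra.
  - pose (sg := INR (S j) / p).
    assert (Hsg : 0 <= sg) by (apply Rmult_le_pos; [apply pos_INR|left; now apply Rinv_0_lt_compat]).
    apply int_le_ext with (f := fun s => plus (scal (dirichlet j ((s - t) / p) * exp (- s)) (f s))
      (scal 2 (scal (cos (sg * (s - t)) * exp (- s)) (f s)))).
    { intros s _.
      rewrite (@scal_assoc R_Ring E), <- (@scal_distr_r R_Ring E); f_equal.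
      cbn [dirichlet].
      replace (INR (S j) * ((s - t) / p)) with (sg * (s - t)) by (unfold sg; field; lra).
      change (dirichlet j ((s - t) / p) * exp (- s) + 2 * (cos (sg * (s - t)) * exp (- s)) =
        (dirichlet j ((s - t) / p) + 2 * cos (sg * (s - t))) * exp (- s)).
      ring. }
    replace (eps * (1 + 2 * decay_sum b p (S j))) with
      (eps * (1 + 2 * decay_sum b p j) + Rabs 2 * (eps * Rpower (1 + sg) (- (1 + b)))).
    2:{ cbn [decay_sum]; fold sg; rewrite Rabs_pos_eq; [ring|lra]. }
    assert (cC : forall s, continuous (fun s => scal (cos (sg * (s - t)) * exp (- s)) (f s)) s).
    { intros s; apply (@continuous_scal R_UniformSpace R_AbsRing E
        (fun s => cos (sg * (s - t)) * exp (- s))); [|apply cf].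
      apply (ex_derive_continuous (fun s => cos (sg * (s - t)) * exp (- s))).
      auto_derive; trivial. }
    apply int_le_plus; [apply cD| |easy|now apply int_le_scal; [apply cC|apply H]].
    intros s; apply (@continuous_scal_r R_UniformSpace R_AbsRing E 2), cC. }
induction m as [|m IH].
- simpl; rewrite Rmult_0_l; apply int_le_zero; intros s _.
  rewrite Rmult_0_l; apply (@scal_zero_l R_Ring E).
- apply int_le_ext with (f := fun s => plus (scal (fejer m ((s - t) / p) * exp (- s)) (f s))
      (scal (dirichlet m ((s - t) / p) * exp (- s)) (f s))).
  { intros s _; rewrite <- (@scal_distr_r R_Ring E); f_equal.
    cbn [fejer]; unfold plus; simpl; ring. }
  rewrite S_INR, Rmult_plus_distr_r, Rmult_1_l.
  apply int_le_plus; [apply cF|apply cD|easy|].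
  apply int_le_mono with (2 := HD m).
  apply Rmult_le_compat_l; [easy|].
  pose proof (@decay_sum_le b p m Hb Hp); lra.
Qed.

(** For nonnegative [s] and [t] the cross term only helps, and squaring [exp (s / 4) >= 1 + s / 4]
    gives [s^2 <= 16 exp (s / 2)], whence [17 = 1 + 16]. The exponent [s / 2] leaves half of the
    weight [exp (- s)] to make the integral converge. *)
Lemma one_plus_sqr_le_exp (t s : R) : 0 <= s -> 0 <= t ->
  1 + (s - t) ^ 2 <= (17 + t ^ 2) * exp (s / 2).
Proof.
intros Hs Ht.
assert (E1 : exp (s / 2) = exp (s / 4) * exp (s / 4)) by (rewrite <- exp_plus; f_equal; field).
pose proof (exp_ineq1_le (s / 4)).
assert (1 + s ^ 2 / 16 <= exp (s / 2)) by (rewrite E1; nra).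
nra.
Qed.

(** Within distance [p] of [t] there is only the central peak, and [fejer_decay] cancels the squared
    distance. Further out the periodic peaks may be as high as [m^2 = p^4], but there
    [p^2 <= (s - t)^2]: the growing period pays for them. *)
Lemma fejer_kernel_decay (p s t : R) (m : nat) : 1 <= p -> INR m = p * p ->
  0 <= s -> 0 <= t ->
  fejer m ((s - t) / p) / p ^ 3 * (exp (- s) - exp (- t)) ^ 2 <= 10 / p * (1 + (s - t) ^ 2).
Proof.
intros Hp Hm Hs Ht.
assert (Ex : forall u, 0 <= u -> 0 < exp (- u) <= 1).
{ intros u Hu; split; [apply exp_pos|]; rewrite <- exp_0.
  destruct (Req_dec u 0) as [->|]; [rewrite Ropp_0; lra|left; apply exp_increasing; lra]. }
assert (X1 : (exp (- s) - exp (- t)) ^ 2 <= 1) by (pose proof (Ex s Hs); pose proof (Ex t Ht); nra).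
assert (X2 : (exp (- s) - exp (- t)) ^ 2 <= (s - t) ^ 2).
{ rewrite <- pow2_abs, <- (pow2_abs (s - t)); apply pow_incr; split; [apply Rabs_pos|].
  now apply exp_lipschitz. }
assert (X0 := pow2_ge_0 (exp (- s) - exp (- t))).
set (z := (exp (- s) - exp (- t)) ^ 2) in *; set (u := s - t) in *.
assert (F0 := fejer_nonneg m (u / p)).
assert (F1 := fejer_le m (u / p)); rewrite Hm in F1.
assert (Hu : u ^ 2 = p ^ 2 * (u / p) ^ 2) by (field; lra).
apply Rmult_le_reg_r with (p ^ 3); [apply pow_lt; lra|].
replace (fejer m (u / p) / p ^ 3 * z * p ^ 3) with (fejer m (u / p) * z) by (field; lra).
replace (10 / p * (1 + u ^ 2) * p ^ 3) with (10 * p ^ 2 * (1 + u ^ 2)) by (field; lra).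
assert (P2 : 0 < p ^ 2) by (apply pow_lt; lra).
pose proof (pow2_ge_0 u).
destruct (Rle_dec ((u / p) ^ 2) 1) as [H1|H1].
- assert (D : fejer m (u / p) * (u / p) ^ 2 <= 10) by (apply fejer_decay; nra).
  apply Rle_trans with (fejer m (u / p) * u ^ 2); [now apply Rmult_le_compat_l|].
  rewrite Hu at 2; nra.
- apply Rle_trans with (p * p * p * p * 1); [apply Rmult_le_compat; nra|].
  assert (p ^ 2 <= u ^ 2) by (rewrite Hu; nra).
  replace (p * p * p * p * 1) with (p ^ 2 * p ^ 2) by ring; nra.
Qed.

(** Three scales meet in the kernel divided by [p^3]: its mass stays above the constant [a], its
    second moment is of order [1 / p], and its integral against [f] is at most
    [eps (1 / p + 2 / b)]. Hence [1 / a = 2 exp (t + 1)] appears in the conclusion. *)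
Lemma fejer_inversion (E : CompleteNormedModule R_AbsRing) (f : R -> E) (B t b eps : R) :
  (forall s, continuous f s) -> 0 <= B -> (forall s, 0 <= s -> norm (f s) <= B) ->
  0 <= t -> 0 < b -> 0 <= eps ->
  (forall sg, 0 <= sg -> int_le (fun s => scal (cos (sg * (s - t)) * exp (- s)) (f s))
     (eps * Rpower (1 + sg) (- (1 + b)))) ->
  norm (f t) <= 2 * exp (t + 1) * (eps * (1 + 2 / b)).
Proof.
intros cf HB Hf Ht Hb Heps HL.
apply le_epsilon; intros eta Heta.
destruct (@exp_modulus E f B t eta) as [K [HK Hmod]]; auto.
pose (a := 1 / 2 * exp (- (t + 1))).
assert (Ha : 0 < a) by (apply Rmult_lt_0_compat; [lra|apply exp_pos]).
enough (Z : a * (norm (f t) - eta) - eps * (1 + 2 / b) <= 0).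
{ apply Rmult_le_reg_l with a; [easy|].
  rewrite (Rmult_plus_distr_l a); unfold a at 2.
  replace (1 / 2 * exp (- (t + 1)) * (2 * exp (t + 1) * (eps * (1 + 2 / b)))) with
    (exp (- (t + 1)) * exp (t + 1) * (eps * (1 + 2 / b))) by (field; lra).
  rewrite <- exp_plus, Rplus_opp_l, exp_0; lra. }
apply le_epsilon_seq with (C := K * (20 * (17 + t ^ 2))).
intros n Hn; set (p := INR n).
assert (Hp : 1 <= p) by (change 1 with (INR 1); apply le_INR; lia).
pose (m := (n * n)%nat).
assert (Hm : INR m = p * p) by apply mult_INR.
assert (Hp3 : 0 < / p ^ 3) by (apply Rinv_0_lt_compat, pow_lt; lra).
(* The peak has height of order [m^2 = p^4] and width of order [p / m = 1 / p], so that [p^3]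
   normalises the mass. *)
set (rho := fun s => fejer m ((s - t) / p) / p ^ 3 * exp (- s)).
assert (dF : forall th, ex_derive (fun th => fejer m th / p ^ 3) th).
{ intros th; auto_derive; apply ex_derive_fejer. }
assert (cr : forall s, continuous rho s).
{ intros s; exact (@continuous_kernel (fun th => fejer m th / p ^ 3) t p s dF). }
assert (Hrho : forall s, 0 <= s -> 0 <= rho s).
{ intros s _; apply Rmult_le_pos; [|left; apply exp_pos].
  apply Rmult_le_pos; [apply fejer_nonneg|lra]. }
(* From [10 / p] in [fejer_kernel_decay], [17 + t^2] in [one_plus_sqr_le_exp], and the integral 2 of
   [exp (- s / 2)]. *)
pose (b' := 20 * (17 + t ^ 2) / p).
assert (Hb' : 0 <= b').
{ apply Rmult_le_pos; [nra|left; apply Rinv_0_lt_compat; lra]. }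
assert (Hd0 : 0 <= eps * (1 + 2 / b)).
{ apply Rmult_le_pos; [easy|].
  assert (0 < 2 / b) by (apply Rdiv_lt_0_compat; lra); lra. }
assert (L : int_le (fun s => scal (rho s) (f s)) (eps * (1 + 2 / b))).
{ apply int_le_ext with (f := fun s => scal (/ p ^ 3) (scal (fejer m ((s - t) / p) * exp (- s)) (f s))).
  { intros s _; rewrite (@scal_assoc R_Ring E); f_equal.
    unfold mult, rho; simpl; unfold mult; simpl; unfold Rdiv; ring. }
  apply (@int_le_mono E _ (Rabs (/ p ^ 3) * (INR m * (eps * (1 + 2 * (p / b)))))).
  { rewrite Rabs_pos_eq by lra; rewrite Hm.
    replace (/ p ^ 3 * (p * p * (eps * (1 + 2 * (p / b))))) with (eps * (/ p + 2 / b)) by (field; lra).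
    apply Rmult_le_compat_l; [easy|].
    assert (/ p <= 1) by (rewrite <- Rinv_1; apply Rinv_le_contravar; lra); lra. }
  apply int_le_scal.
  { intros s; apply (@continuous_scal R_UniformSpace R_AbsRing E
      (fun s => fejer m ((s - t) / p) * exp (- s))); [|apply cf].
    apply continuous_kernel, ex_derive_fejer. }
  apply fejer_int_le; auto; lra. }
assert (Hd : forall d, 0 < d -> a * (norm (f t) - eta) <= (eps * (1 + 2 / b) + d) + K * b').
{ intros d Hd.
  destruct (L d Hd) as [M HM].
  pose (T := Rmax (M + 1) (t + 1)).
  assert (HT1 : M < T) by (assert (M + 1 <= T) by apply Rmax_l; lra).
  assert (HT2 : t + 1 <= T) by apply Rmax_r.
  specialize (HM T HT1).
  apply (@approximate_identity E f rho t T eta K a b' (eps * (1 + 2 / b) + d)); auto; try lra.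
  - assert (Hip : 0 < / p <= 1).
    { split; [apply Rinv_0_lt_compat; lra|rewrite <- Rinv_1; apply Rinv_le_contravar; lra]. }
    (* On [[t, t + 1 / p]] all the angles [k (s - t) / p] with [k <= p^2] are at most 1, so every
       cosine is at least [1 / 2]. *)
    replace a with (p / 2 * exp (- (t + 1)) * ((t + / p) - t)) by (unfold a; field; lra).
    apply RInt_lower; auto; try lra.
    intros s Hs; unfold rho; apply Rmult_le_compat; [lra|left; apply exp_pos| |].
    + apply Rmult_le_reg_r with (p ^ 3); [apply pow_lt; lra|].
      replace (fejer m ((s - t) / p) / p ^ 3 * p ^ 3) with (fejer m ((s - t) / p)) by (field; lra).
      replace (p / 2 * p ^ 3) with (INR m * INR m * (1 / 2)) by (rewrite Hm; field).
      apply fejer_ge; [lra|]; intros k Hk.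
      apply cos_ge_half.
      assert (0 <= INR k <= p * p) by (split; [apply pos_INR|rewrite <- Hm; now apply le_INR]).
      assert (0 <= (s - t) / p <= / (p * p)).
      { split; [apply Rmult_le_pos; lra|].
        rewrite Rinv_mult; apply Rmult_le_compat_r; lra. }
      assert (0 <= INR k * ((s - t) / p)) by (apply Rmult_le_pos; lra).
      assert (INR k * ((s - t) / p) <= p * p * / (p * p)) by (apply Rmult_le_compat; lra).
      rewrite Rinv_r in * by nra; lra.
    + destruct (Req_dec s (t + 1)) as [->|]; [lra|left; apply exp_increasing; lra].
  - replace b' with (10 / p * (17 + t ^ 2) / (1 / 2)) by (unfold b'; field; lra).
    assert (Q : 0 <= 10 / p) by (apply Rmult_le_pos; [lra|left; apply Rinv_0_lt_compat; lra]).
    apply Rle_trans with (2 := @RInt_exp_le (1 / 2) (10 / p * (17 + t ^ 2)) T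
      ltac:(lra) ltac:(lra) ltac:(nra)).
    apply RInt_le; [lra| | |].
    + apply (@ex_RInt_cont R_CompleteNormedModule); intros s.
      apply (@continuous_mult R_UniformSpace R_AbsRing rho (fun s => (exp (- s) - exp (- t)) ^ 2));
        [apply cr|].
      apply (ex_derive_continuous (fun s => (exp (- s) - exp (- t)) ^ 2)); auto_derive; trivial.
    + apply (@ex_RInt_cont R_CompleteNormedModule); intros s.
      apply (ex_derive_continuous (fun s => 10 / p * (17 + t ^ 2) * exp (- (1 / 2 * s)))).
      auto_derive; trivial.
    + intros s Hs; unfold rho.
      assert (D := @fejer_kernel_decay p s t m Hp Hm ltac:(lra) Ht).
      assert (O := @one_plus_sqr_le_exp t s ltac:(lra) Ht).
      assert (EE : exp (- (1 / 2 * s)) = exp (s / 2) * exp (- s))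
        by (rewrite <- exp_plus; f_equal; field).
      rewrite EE; pose proof (exp_pos (- s)).
      set (w := fejer m ((s - t) / p) / p ^ 3) in *; set (z := (exp (- s) - exp (- t)) ^ 2) in *.
      apply Rle_trans with (10 / p * (1 + (s - t) ^ 2) * exp (- s)).
      * replace (w * exp (- s) * z) with (w * z * exp (- s)) by ring.
        apply Rmult_le_compat_r; lra.
      * replace (10 / p * (17 + t ^ 2) * (exp (s / 2) * exp (- s))) with
          (10 / p * ((17 + t ^ 2) * exp (s / 2)) * exp (- s)) by ring.
        apply Rmult_le_compat_r; [lra|]; now apply Rmult_le_compat_l. }
assert (Hfin : a * (norm (f t) - eta) <= eps * (1 + 2 / b) + K * b').
{ apply le_epsilon; intros d Hd'; specialize (Hd d Hd'); lra. }
replace (K * (20 * (17 + t ^ 2)) / p) with (K * b') by (unfold b'; field; lra).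
lra.
Qed.

(** * Linear identities in complex vector spaces *)

(** Syntax for a proof by reflection: an expression linear in its atoms is determined by the
    coefficient of each atom, and equality of vectors follows from scalar equations. *)
Inductive mexp : Type :=
  | MVar : nat -> mexp
  | MZero : mexp
  | MPlus : mexp -> mexp -> mexp
  | MOpp : mexp -> mexp
  | MScal : C -> mexp -> mexp.

Fixpoint meval (V : ModuleSpace C_Ring) (vs : list V) (e : mexp) : V :=
  match e with
  | MVar i => nth i vs zero
  | MZero => zero
  | MPlus a b => plus (meval vs a) (meval vs b)
  | MOpp a => opp (meval vs a)
  | MScal k a => scal (k : C_Ring) (meval vs a)
  end.

Fixpoint mcoef (e : mexp) (i : nat) : C :=
  match e with
  | MVar j => if Nat.eqb i j then RtoC 1 else RtoC 0
  | MZero => RtoC 0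
  | MPlus a b => Cplus (mcoef a i) (mcoef b i)
  | MOpp a => Copp (mcoef a i)
  | MScal k a => Cmult k (mcoef a i)
  end.

Fixpoint lincomb (V : ModuleSpace C_Ring) (vs : list V) (c : nat -> C) (n : nat) : V :=
  match n with
  | O => zero
  | S m => plus (lincomb vs c m) (scal (c m : C_Ring) (nth m vs zero))
  end.

Lemma lincomb_ext (V : ModuleSpace C_Ring) (vs : list V) (c d : nat -> C) (n : nat) :
  (forall i, (i < n)%nat -> c i = d i) -> lincomb vs c n = lincomb vs d n.
Proof.
induction n as [|n IH]; intros H; simpl; [easy|].
rewrite IH by (intros i Hi; apply H; lia); now rewrite H by lia.
Qed.

Lemma lincomb_zero (V : ModuleSpace C_Ring) (vs : list V) (n : nat) :
  lincomb vs (fun _ => RtoC 0) n = zero.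
Proof.
induction n as [|n IH]; simpl; [easy|].
rewrite IH, plus_zero_l; apply (scal_zero_l (nth n vs zero)).
Qed.

Lemma lincomb_var (V : ModuleSpace C_Ring) (vs : list V) (j n : nat) :
  lincomb vs (mcoef (MVar j)) n = if Nat.ltb j n then nth j vs zero else zero.
Proof.
induction n as [|n IH]; [easy|].
cbn [lincomb]; rewrite IH; cbn [mcoef].
destruct (Nat.eqb_spec n j) as [->|Hn].
- rewrite Nat.ltb_irrefl, plus_zero_l.
  replace (Nat.ltb j (S j)) with true by (symmetry; apply Nat.ltb_lt; lia).
  apply (scal_one (nth j vs zero)).
- replace (Nat.ltb j (S n)) with (Nat.ltb j n).
  + etransitivity; [|apply plus_zero_r]; f_equal.
    apply (scal_zero_l (nth n vs zero)).
  + apply Bool.eq_iff_eq_true; rewrite !Nat.ltb_lt; lia.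
Qed.

Lemma lincomb_plus (V : ModuleSpace C_Ring) (vs : list V) (c d : nat -> C) (n : nat) :
  lincomb vs (fun i => Cplus (c i) (d i)) n = plus (lincomb vs c n) (lincomb vs d n).
Proof.
induction n as [|n IH]; simpl; [now rewrite plus_zero_l|].
rewrite IH; change (Cplus (c n) (d n)) with (plus (c n : C_Ring) (d n)).
rewrite scal_distr_r, !plus_assoc; f_equal.
rewrite <- !plus_assoc; f_equal; apply plus_comm.
Qed.

Lemma lincomb_scal (V : ModuleSpace C_Ring) (vs : list V) (k : C) (c : nat -> C) (n : nat) :
  lincomb vs (fun i => Cmult k (c i)) n = scal (k : C_Ring) (lincomb vs c n).
Proof.
induction n as [|n IH]; simpl; [now rewrite scal_zero_r|].
rewrite IH, scal_distr_l, scal_assoc; reflexivity.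
Qed.

Lemma meval_lincomb (V : ModuleSpace C_Ring) (vs : list V) (e : mexp) :
  meval vs e = lincomb vs (mcoef e) (length vs).
Proof.
induction e as [i| |a IHa b IHb|a IHa|k a IHa]; cbn [meval].
- rewrite lincomb_var; destruct (Nat.ltb_spec i (length vs)); [easy|].
  now apply nth_overflow.
- symmetry; apply lincomb_zero.
- rewrite IHa, IHb; symmetry; apply lincomb_plus.
- rewrite IHa, <- (scal_opp_one (lincomb _ _ _)).
  rewrite <- lincomb_scal; apply lincomb_ext; intros i _; cbn [mcoef].
  change (Cmult (Copp (RtoC 1)) (mcoef a i) = Copp (mcoef a i)); ring.
- rewrite IHa; symmetry; apply lincomb_scal.
Qed.

(** A recursive conjunction rather than a quantified statement, so that computation unfolds it into
    one scalar goal per atom. *)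
Fixpoint coefs_agree (a b : mexp) (n : nat) : Prop :=
  match n with
  | O => True
  | S m => mcoef a m = mcoef b m /\ coefs_agree a b m
  end.

Lemma module_eq (V : ModuleSpace C_Ring) (vs : list V) (a b : mexp) :
  coefs_agree a b (length vs) -> meval vs a = meval vs b.
Proof.
intros H; rewrite !meval_lincomb; apply lincomb_ext.
induction (length vs) as [|n IH]; [lia|].
destruct H as [H1 H2]; intros i Hi.
destruct (Nat.eq_dec i n) as [->|]; [easy|apply IH; [easy|lia]].
Qed.

Ltac mem_list x l :=
  lazymatch l with
  | nil => constr:(false)
  | x :: _ => constr:(true)
  | _ :: ?l' => mem_list x l'
  end.

Ltac index_list x l :=
  lazymatch l with
  | x :: _ => constr:(O)
  | _ :: ?l' => let n := index_list x l' in constr:(S n)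
  end.

Ltac collect e l :=
  lazymatch e with
  | plus ?a ?b => let l1 := collect a l in collect b l1
  | minus ?a ?b => let l1 := collect a l in collect b l1
  | opp ?a => collect a l
  | scal _ ?a => collect a l
  | zero => l
  | _ => lazymatch mem_list e l with true => l | false => constr:(e :: l) end
  end.

Ltac reify e l :=
  lazymatch e with
  | plus ?a ?b => let a' := reify a l in let b' := reify b l in constr:(MPlus a' b')
  | minus ?a ?b => let a' := reify a l in let b' := reify b l in constr:(MPlus a' (MOpp b'))
  | opp ?a => let a' := reify a l in constr:(MOpp a')
  | scal ?k ?a => let a' := reify a l in constr:(MScal k a')
  | zero => constr:(MZero)
  | _ => let i := index_list e l in constr:(MVar i)
  end.

(* Reduces a linear identity between vectors to identities between the complex
   coefficients of its atoms. *)
Ltac module_coefs V :=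
  lazymatch goal with
  | |- ?a = ?b =>
    let l0 := collect a (@nil (ModuleSpace.sort C_Ring V)) in
    let l := collect b l0 in
    let a' := reify a l in
    let b' := reify b l in
    change (meval (V := V) l a' = meval (V := V) l b');
    apply (@module_eq V l a' b');
    cbn [length coefs_agree mcoef Nat.eqb];
    repeat match goal with
    | |- _ /\ _ => split
    | |- True => exact I
    end
  end.

(** * Calculus with complex scalars *)

Lemma is_linear_realification (X : CompleteNormedModule C_AbsRing) (L : X -> X) :
  is_linear L -> is_linear (L : realification X -> realification X).
Proof.
intros [Hp Hs Hn]; constructor; [exact Hp| |exact Hn].
intros k x; exact (Hs (RtoC k) x).
Qed.

Lemma is_linear_scal_C (X : CompleteNormedModule C_AbsRing) (k : C) :
  is_linear (fun x : X => scal (k : C_AbsRing) x).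
Proof. apply (@is_linear_scal_r C_AbsRing X); exact Cmult_comm. Qed.

Lemma is_linear_comb (X : CompleteNormedModule C_AbsRing) (k l : C) (L : X -> X) :
  is_linear L ->
  is_linear (fun x : X => plus (scal (k : C_AbsRing) (L x)) (scal (l : C_AbsRing) x)).
Proof.
intros HL; destruct (linear_norm _ HL) as [M [HM HN]].
constructor.
- intros x y; rewrite (linear_plus _ HL); module_coefs X; ring.
- intros c x; rewrite (linear_scal _ HL); module_coefs X; ring.
(* The summand 1 keeps the constant strictly positive even if [k] and [l] vanish. *)
- exists (Cmod k * M + Cmod l + 1).
  pose proof (Cmod_ge_0 k); pose proof (Cmod_ge_0 l).
  assert (0 <= Cmod k * M) by nra.
  split; [lra|]; intros x.
  apply Rle_trans with (1 := @norm_triangle C_AbsRing X _ _).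
  pose proof (@norm_scal C_AbsRing X k (L x)) as N1.
  pose proof (@norm_scal C_AbsRing X l x) as N2.
  change (abs (k : C_AbsRing)) with (Cmod k) in N1; change (abs (l : C_AbsRing)) with (Cmod l) in N2.
  specialize (HN x); pose proof (@norm_ge_0 C_AbsRing X x).
  assert (Cmod k * norm (L x) <= Cmod k * (M * norm x)) by now apply Rmult_le_compat_l.
  apply Rle_trans with (Cmod k * norm (L x) + Cmod l * norm x);
    [apply Rplus_le_compat; [exact N1|exact N2]|lra].
Qed.

Lemma is_derive_clinear (X : CompleteNormedModule C_AbsRing) (L : X -> X)
  (W : R -> realification X) (s : R) (W' : realification X) :
  is_linear L -> is_derive W s W' ->
  is_derive (fun s => L (W s) : realification X) s (L W' : realification X).
Proof.
intros HL HW; apply is_linear_realification in HL.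
unfold is_derive.
apply filterdiff_ext_lin with (fun y : R => (L : realification X -> realification X) (scal y W')).
- apply (@filterdiff_comp' R_AbsRing R_NormedModule (realif_NormedModule X) (realif_NormedModule X) W
    (L : realification X -> realification X)); [exact HW|].
  now apply filterdiff_linear.
- intros y; exact (linear_scal _ HL y W').
Qed.

Lemma is_derive_scal_vect (E : NormedModule R_AbsRing) (a : R -> R) (W : R -> E)
  (s a' : R) (W' : E) : is_derive a s a' -> is_derive W s W' ->
  is_derive (fun s => scal (a s) (W s)) s (plus (scal a' (W s)) (scal (a s) W')).
Proof.
intros Ha HW; unfold is_derive.
apply filterdiff_ext_lin with
  (fun y : R => plus (scal (scal y a') (W s)) (scal (a s) (scal y W'))).
- apply (@filterdiff_scal_fct R_AbsRing R_NormedModule E s a W); try easy.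
  exact Rmult_comm.
- intros y; rewrite scal_distr_l, !scal_assoc; f_equal; f_equal; exact (Rmult_comm _ _).
Qed.

(* [exp (- lam s)] *)
Definition cexp (lam : C) (s : R) : C :=
  (exp (- (Re lam * s)) * cos (Im lam * s), - (exp (- (Re lam * s)) * sin (Im lam * s))).

Lemma Cmod_cexp (lam : C) (s : R) : Cmod (cexp lam s) = exp (- (Re lam * s)).
Proof.
unfold Cmod, cexp; simpl.
set (e := exp (- (Re lam * s))).
replace (_ + _) with (e ^ 2 * ((sin (Im lam * s))² + (cos (Im lam * s))²)) by (unfold Rsqr; ring).
rewrite sin2_cos2, Rmult_1_r; apply sqrt_pow2; left; apply exp_pos.
Qed.

(** Reduces a complex factor to two real ones, for which the rules of real calculus apply;
    multiplication by [Ci] is a fixed bounded linear map. *)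
Lemma scal_pair (X : CompleteNormedModule C_AbsRing) (a b : R) (v : X) :
  scal ((a, b) : C_AbsRing) v =
  plus (scal (RtoC a : C_AbsRing) v) (scal (Ci : C_AbsRing) (scal (RtoC b : C_AbsRing) v)).
Proof.
module_coefs X; apply injective_projections; simpl; ring.
Qed.

Lemma is_derive_cexp_scal (X : CompleteNormedModule C_AbsRing) (lam : C)
  (W : R -> realification X) (s : R) (W' : realification X) :
  is_derive W s W' ->
  is_derive (fun s => scal (cexp lam s : C_AbsRing) (W s : X) : realification X) s
    (scal (cexp lam s : C_AbsRing) (minus (W' : X) (scal (lam : C_AbsRing) (W s : X)))
      : realification X).
Proof.
intros HW.
pose (a := fun s => exp (- (Re lam * s)) * cos (Im lam * s)).
pose (b := fun s => - (exp (- (Re lam * s)) * sin (Im lam * s))).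
(* The real and imaginary parts of the equation [e' = - lam e] for [e = cexp lam]. *)
pose (a' := - Re lam * a s + Im lam * b s).
pose (b' := - Re lam * b s - Im lam * a s).
assert (Ha : is_derive a s a') by (unfold a, a', b, a; auto_derive; trivial; ring).
assert (Hb : is_derive b s b') by (unfold b, b', a, b; auto_derive; trivial; ring).
pose proof (is_derive_scal_vect Ha HW) as D1.
pose proof (is_derive_clinear (is_linear_scal_C X Ci) (is_derive_scal_vect Hb HW)) as D2.
pose proof (is_derive_plus _ _ _ _ _ D1 D2) as D.
eapply is_derive_ext in D.
2:{ intros u; symmetry; exact (scal_pair (a u) (b u) (W u : X)). }
match type of D with is_derive _ _ ?l =>
  replace l with (scal (cexp lam s : C_AbsRing) (minus (W' : X) (scal (lam : C_AbsRing) (W s : X)))) in D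
end; [exact D|].
change (scal (cexp lam s : C_AbsRing) (minus (W' : X) (scal (lam : C_AbsRing) (W s : X))) =
  plus (plus (scal (RtoC a' : C_AbsRing) (W s : X)) (scal (RtoC (a s) : C_AbsRing) (W' : X)))
    (scal (Ci : C_AbsRing) (plus (scal (RtoC b' : C_AbsRing) (W s : X)) (scal (RtoC (b s) : C_AbsRing) (W' : X))))).
change (cexp lam s) with ((a s, b s) : C).
module_coefs X; apply injective_projections; unfold a', b'; simpl; destruct lam; simpl; ring.
Qed.

Lemma continuous_scal_C (X : CompleteNormedModule C_AbsRing) (k : R -> C) (f : R -> realification X) (s : R) :
  continuous (fun s => Re (k s)) s -> continuous (fun s => Im (k s)) s -> continuous f s ->
  continuous (fun s => scal (k s : C_AbsRing) (f s : X) : realification X) s.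
Proof.
intros Hr Hi Hf.
apply continuous_ext with (fun s => plus (scal (Re (k s)) (f s))
  (scal (Ci : C_AbsRing) (scal (Im (k s)) (f s) : X) : realification X)).
{ intros u; change (plus (scal (RtoC (Re (k u)) : C_AbsRing) (f u : X))
    (scal (Ci : C_AbsRing) (scal (RtoC (Im (k u)) : C_AbsRing) (f u : X))) = scal (k u : C_AbsRing) (f u : X)).
  rewrite <- scal_pair; now destruct (k u). }
apply (@continuous_plus R_UniformSpace R_AbsRing (realif_NormedModule X)).
- now apply (@continuous_scal R_UniformSpace R_AbsRing (realif_NormedModule X)).
- apply (@continuous_comp R_UniformSpace (realif_UniformSpace X) (realif_UniformSpace X)
    (fun s => scal (Im (k s)) (f s)) (fun v => scal (Ci : C_AbsRing) (v : X) : realification X)).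
  + now apply (@continuous_scal R_UniformSpace R_AbsRing (realif_NormedModule X)).
  + apply (@linear_cont R_AbsRing (realif_NormedModule X) (realif_NormedModule X)), is_linear_realification,
      is_linear_scal_C.
Qed.

Lemma continuous_clinear (X : CompleteNormedModule C_AbsRing) (L : X -> X) (f : R -> realification X) (s : R) :
  is_linear L -> continuous f s -> continuous (fun s => L (f s) : realification X) s.
Proof.
intros HL Hf.
apply (@continuous_comp R_UniformSpace (realif_UniformSpace X) (realif_UniformSpace X) f
  (L : realification X -> realification X)); [easy|].
now apply (@linear_cont R_AbsRing (realif_NormedModule X) (realif_NormedModule X)),
  is_linear_realification.
Qed.

Lemma continuous_cexp_scal (X : CompleteNormedModule C_AbsRing) (lam : C) (f : R -> realification X) (s : R) :
  continuous f s -> continuous (fun s => scal (cexp lam s : C_AbsRing) (f s : X) : realification X) s.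
Proof.
intros Hf; apply continuous_scal_C; [| |easy].
- apply (ex_derive_continuous (fun s => exp (- (Re lam * s)) * cos (Im lam * s))).
  auto_derive; trivial.
- apply (ex_derive_continuous (fun s => - (exp (- (Re lam * s)) * sin (Im lam * s)))).
  auto_derive; trivial.
Qed.

Lemma is_derive_primitive (E : CompleteNormedModule R_AbsRing) (f : R -> E) (s : R) :
  (forall s, continuous f s) -> is_derive (fun u => RInt f 0 u) s (f s).
Proof.
intros cf; apply (@is_derive_RInt E f (fun u => RInt f 0 u) 0); [|apply cf].
apply filter_forall; intros v; now apply is_RInt_cont.
Qed.

Lemma RInt_clinear (X : CompleteNormedModule C_AbsRing) (L : X -> X) (f : R -> realification X) (T : R) :
  is_linear L -> (forall s, continuous f s) ->
  RInt (fun s => L (f s) : realification X) 0 T = L (RInt f 0 T).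
Proof.
intros HL cf; apply is_RInt_unique.
replace (L (RInt f 0 T) : realification X) with
  (minus (L (RInt f 0 T) : realification X) (L (RInt f 0 0) : realification X)).
- apply (@is_RInt_derive (realif_CompleteNormedModule X) (fun u => L (RInt f 0 u) : realification X)
    (fun s => L (f s) : realification X)).
  + intros s _; now apply is_derive_clinear, is_derive_primitive.
  + intros s _; now apply continuous_clinear.
- rewrite RInt_point; change (minus (L (RInt f 0 T)) (L (zero : X)) = L (RInt f 0 T)).
  transitivity (minus (L (RInt f 0 T)) (zero : X)); [|apply (@minus_zero_r X)].
  f_equal; exact (linear_zero L HL).
Qed.

(** * Improper Laplace integrals *)

Definition int_lim (E : CompleteNormedModule R_AbsRing) (f : R -> E) (J : E) : Prop :=
  filterlim (fun T => RInt f 0 T) (Rbar_locally p_infty) (locally J).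

Lemma int_lim_ext (E : CompleteNormedModule R_AbsRing) (f g : R -> E) (J : E) :
  (forall s, 0 < s -> f s = g s) -> int_lim f J -> int_lim g J.
Proof.
intros H; apply filterlim_ext_loc; exists 0; intros T HT.
apply (@RInt_ext E); intros s; rewrite Rmin_left by lra; intros Hs; apply H; lra.
Qed.

Lemma int_lim_plus (E : CompleteNormedModule R_AbsRing) (f g : R -> E) (I J : E) :
  (forall s, continuous f s) -> (forall s, continuous g s) ->
  int_lim f I -> int_lim g J -> int_lim (fun s => plus (f s) (g s)) (plus I J).
Proof.
intros cf cg HI HJ; unfold int_lim.
apply filterlim_ext with (fun T => plus (RInt f 0 T) (RInt g 0 T)).
- intros T; symmetry; apply (@RInt_plus E); now apply ex_RInt_cont.
- apply (filterlim_comp_2 _ _ _ HI HJ), (@filterlim_plus R_AbsRing E).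
Qed.

Lemma int_lim_clinear (X : CompleteNormedModule C_AbsRing) (L : X -> X)
  (f : R -> realification X) (J : realification X) : is_linear L ->
  (forall s, continuous f s) -> int_lim f J ->
  int_lim (fun s => L (f s) : realification X) (L J : realification X).
Proof.
intros HL cf HJ; unfold int_lim.
apply filterlim_ext with (fun T => L (RInt f 0 T) : realification X).
- intros T; symmetry; now apply RInt_clinear.
- apply (filterlim_comp _ _ _ _ _ _ _ _ HJ).
  now apply (@linear_cont R_AbsRing (realif_NormedModule X) (realif_NormedModule X)),
    is_linear_realification.
Qed.

Lemma int_lim_int_le (E : CompleteNormedModule R_AbsRing) (f : R -> E) (J : E) :
  int_lim f J -> int_le f (norm J).
Proof.
intros H eps Heps.
assert (N := filterlim_comp _ _ _ _ _ _ _ _ H (@filterlim_norm R_AbsRing E J)).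
specialize (N _ (locally_ball (norm J) (mkposreal eps Heps))).
destruct N as [M HM]; exists M; intros T HT; specialize (HM T HT).
revert HM; unfold ball; simpl; unfold AbsRing_ball, abs, minus, plus, opp; simpl; intros HM.
apply Rabs_def2 in HM; lra.
Qed.

Lemma int_lim_of_gen (E : CompleteNormedModule R_AbsRing) (f : R -> E) (J : E) :
  is_RInt_gen f (at_point 0) (Rbar_locally p_infty) J -> int_lim f J.
Proof.
intros H P HP; destruct (H P HP) as [Q1 Q2 H1 H2 H3].
destruct H2 as [M HM]; exists M; intros T HT.
destruct (H3 0 T) as [y [Hy1 Hy2]]; [exact H1|now apply HM|].
simpl in Hy1; now rewrite (is_RInt_unique _ _ _ _ Hy1).
Qed.

Lemma exp_decay_lim (D d : R) : 0 < d ->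
  filterlim (fun T => D * exp (- (d * T))) (Rbar_locally p_infty) (locally 0).
Proof.
intros Hd; apply filterlim_locally; intros eps.
assert (He := cond_pos eps).
exists (Rmax 0 (Rabs D / (d * eps))); intros T HT.
pose proof (Rmax_l 0 (Rabs D / (d * eps))); pose proof (Rmax_r 0 (Rabs D / (d * eps))).
unfold ball; simpl; unfold AbsRing_ball, abs, minus, plus, opp; simpl.
rewrite Ropp_0, Rplus_0_r, Rabs_mult, (Rabs_pos_eq (exp _)) by (left; apply exp_pos).
assert (dT : 0 < d * T) by (apply Rmult_lt_0_compat; lra).
assert (E1 : exp (- (d * T)) * exp (d * T) = 1) by (rewrite <- exp_plus, Rplus_opp_l; apply exp_0).
pose proof (exp_ineq1_le (d * T)); pose proof (exp_pos (- (d * T))); pose proof (Rabs_pos D).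
assert (Rabs D < d * T * eps).
{ replace (Rabs D) with (Rabs D / (d * eps) * (d * eps)) by (field; lra).
  replace (d * T * eps) with (T * (d * eps)) by ring.
  apply Rmult_lt_compat_r; [apply Rmult_lt_0_compat|]; lra. }
apply Rmult_lt_reg_r with (exp (d * T)); [apply exp_pos|].
rewrite Rmult_assoc, E1; nra.
Qed.

Lemma exp_le (a b : R) : a <= b -> exp a <= exp b.
Proof. intros [H| ->]; [left; now apply exp_increasing|lra]. Qed.

(** The integrand is the derivative of [cexp lam s] times [G s = L (W s) + c1 + s c2]. This product
    starts at [c1] and tends to zero because [kap < Re lam]. Both Laplace computations below are
    instances, with [L], [c1], [c2] fitted to the integrand wanted. *)
Lemma laplace_affine (X : CompleteNormedModule C_AbsRing) (lam : C) (L : X -> X) (c1 c2 : X)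
  (W U : R -> realification X) (kap M : R) :
  (forall s, is_derive W s (U s)) -> (forall s, continuous U s) -> is_linear L ->
  0 <= kap < Re lam -> W 0 = zero ->
  (forall s, 0 <= s -> norm (W s) <= M * exp (kap * s)) ->
  int_lim (fun s => scal (cexp lam s : C_AbsRing)
    (minus (plus (L (U s)) c2)
       (scal (lam : C_AbsRing) (plus (L (W s)) (plus c1 (scal (RtoC s : C_AbsRing) c2)))))
     : realification X) (opp c1 : realification X).
Proof.
intros HW cU HL Hk W0 HM.
destruct (linear_norm _ HL) as [ML [HML HN]].
pose (G := fun s => plus (L (W s)) (plus c1 (scal (RtoC s : C_AbsRing) c2)) : realification X).
pose (G' := fun s => plus (L (U s)) c2 : realification X).
assert (DG : forall s, is_derive G s (G' s)).
{ intros s.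
  assert (D1 : is_derive (fun s => L (W s) : realification X) s (L (U s) : realification X))
    by now apply is_derive_clinear.
  assert (D2 : is_derive (fun s => plus c1 (scal (RtoC s : C_AbsRing) c2) : realification X) s
     (c2 : realification X)).
  { assert (D3 := @is_derive_scal_l R_AbsRing (realif_NormedModule X) (fun s => s) s 1
      (c2 : realification X) (is_derive_id s)).
    assert (D4 := @is_derive_const R_AbsRing (realif_NormedModule X) (c1 : realification X) s).
    assert (D5 := is_derive_plus _ _ _ _ _ D4 D3).
    apply (@eq_ind (realification X) _ (fun l => is_derive
      (fun s => plus c1 (scal (RtoC s : C_AbsRing) c2) : realification X) s l) D5).
    etransitivity; [apply (@plus_zero_l (realif_AbelianGroup X))|].
    exact (scal_one (c2 : realification X)). }
  exact (is_derive_plus _ _ _ _ _ D1 D2). }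
assert (cG : forall s, continuous G s).
{ intros s; apply (@ex_derive_continuous R_AbsRing (realif_NormedModule X)); eexists; apply DG. }
assert (cG' : forall s, continuous G' s).
{ intros s; apply (@continuous_plus R_UniformSpace R_AbsRing (realif_NormedModule X)).
  - now apply continuous_clinear.
  - apply (@continuous_const R_UniformSpace (realif_UniformSpace X)). }
pose (Hf := fun s => scal (cexp lam s : C_AbsRing) (G s : X) : realification X).
assert (I : forall T, RInt (fun s => scal (cexp lam s : C_AbsRing)
   (minus (G' s : X) (scal (lam : C_AbsRing) (G s : X))) : realification X) 0 T =
   minus (Hf T) (Hf 0)).
{ intros T; apply is_RInt_unique.
  apply (@is_RInt_derive (realif_CompleteNormedModule X) Hf).
  - intros s _; now apply is_derive_cexp_scal.
  - intros s _; apply continuous_cexp_scal.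
    apply (@continuous_minus R_UniformSpace R_AbsRing (realif_NormedModule X) G'
      (fun s => scal (lam : C_AbsRing) (G s : X) : realification X)); [easy|].
    apply continuous_clinear; [apply is_linear_scal_C|easy]. }
unfold int_lim; eapply filterlim_ext; [intros T; symmetry; apply I|].
assert (H0 : Hf 0 = c1).
{ unfold Hf, G; rewrite W0.
  transitivity (scal (RtoC 1 : C_AbsRing) (plus (zero : X) (plus c1 (scal (RtoC 0 : C_AbsRing) c2)))).
  - f_equal; [|f_equal; exact (linear_zero L HL)].
    unfold cexp; rewrite !Rmult_0_r, Ropp_0, exp_0, cos_0, sin_0.
    apply injective_projections; simpl; ring.
  - module_coefs X; ring. }
assert (Lz : filterlim Hf (Rbar_locally p_infty) (locally (zero : realification X))).
{ apply (@filterlim_norm_zero R R_AbsRing (realif_NormedModule X) _ _).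
  (* An exponent strictly above [kap] leaves room for the term linear in [s]; staying below [Re lam]
     it still gives decay. *)
  pose (k' := (kap + Re lam) / 2).
  assert (Hk' : kap < k' < Re lam) by (unfold k'; lra).
  assert (HM0 : 0 <= M).
  { specialize (HM 0 (Rle_refl 0)); rewrite W0, Rmult_0_r, exp_0, Rmult_1_r in HM.
    apply Rle_trans with (2 := HM), norm_ge_0. }
  pose (D := ML * M + norm c1 + / k' * norm c2).
  assert (HG : forall T, 0 <= T -> norm (G T) <= D * exp (k' * T)).
  { intros T HT; unfold G.
    assert (N1 : norm (L (W T)) <= ML * (M * exp (kap * T))).
    { apply Rle_trans with (1 := HN _); apply Rmult_le_compat_l; [lra|now apply HM]. }
    assert (N2 : norm (scal (RtoC T : C_AbsRing) c2) <= T * norm c2).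
    { apply Rle_trans with (1 := @norm_scal C_AbsRing X _ _); apply Req_le; f_equal.
      transitivity (Rabs T); [exact (Cmod_R T)|now apply Rabs_pos_eq]. }
    assert (N3 := @norm_triangle C_AbsRing X (L (W T)) (plus c1 (scal (RtoC T : C_AbsRing) c2))).
    assert (N4 := @norm_triangle C_AbsRing X c1 (scal (RtoC T : C_AbsRing) c2)).
    assert (P1 := @norm_ge_0 C_AbsRing X c1); assert (P2 := @norm_ge_0 C_AbsRing X c2).
    assert (X1 : exp (kap * T) <= exp (k' * T)) by (apply exp_le; nra).
    assert (X2 := exp_ineq1_le (k' * T)).
    assert (X3 : T <= / k' * exp (k' * T)).
    { apply Rmult_le_reg_l with k'; [lra|]; rewrite <- Rmult_assoc, Rinv_r; lra. }
    apply Rle_trans with (1 := N3).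
    apply Rle_trans with (ML * (M * exp (kap * T)) + (norm c1 + T * norm c2));
      [apply Rplus_le_compat; [exact N1|apply Rle_trans with (1 := N4); lra]|].
    unfold D; rewrite !Rmult_plus_distr_r, Rplus_assoc.
    apply Rplus_le_compat; [|apply Rplus_le_compat].
    - rewrite Rmult_assoc; apply Rmult_le_compat_l; [lra|now apply Rmult_le_compat_l].
    - assert (1 <= exp (k' * T)) by nra; nra.
    - nra. }
  assert (B : forall T, 0 <= T -> norm (Hf T) <= D * exp (- ((Re lam - k') * T))).
  { intros T HT; apply Rle_trans with (1 := @norm_scal C_AbsRing X _ _).
    change (abs (cexp lam T : C_AbsRing)) with (Cmod (cexp lam T)); rewrite Cmod_cexp.
    replace (- ((Re lam - k') * T)) with (- (Re lam * T) + k' * T) by ring.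
    rewrite exp_plus; specialize (HG T HT); pose proof (exp_pos (- (Re lam * T))).
    replace (D * (exp (- (Re lam * T)) * exp (k' * T))) with
      (exp (- (Re lam * T)) * (D * exp (k' * T))) by ring.
    apply Rmult_le_compat_l; [lra|exact HG]. }
  refine (@filterlim_le_le R (Rbar_locally p_infty) _ (fun _ => 0) _
    (fun T => D * exp (- ((Re lam - k') * T))) (Finite 0) _ _ _).
  - exists 0; intros T HT; split; [apply norm_ge_0|apply B; lra].
  - apply filterlim_const.
  - apply exp_decay_lim; lra. }
rewrite H0; unfold minus.
replace (opp c1 : realification X) with (plus (zero : realification X) (opp (c1 : realification X)))
  by apply (@plus_zero_l (realif_AbelianGroup X)).
apply (filterlim_comp_2 _ _ _ Lz (filterlim_const (opp (c1 : realification X)))),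
  (@filterlim_plus R_AbsRing (realif_NormedModule X)).
Qed.

(** * Laplace transform of an integrated semigroup *)

Lemma resolvent_spec (X : CompleteNormedModule C_AbsRing) (A : closed_operator X) (lam : C) (y : X) :
  resolvent_set A lam -> resolvent_eq A lam y (resolvent A lam y).
Proof. intros [H _]; unfold resolvent; apply (@iota_correct C_AbsRing X), H. Qed.

Lemma resolvent_unique (X : CompleteNormedModule C_AbsRing) (A : closed_operator X) (lam : C) (x y : X) :
  resolvent_set A lam -> resolvent_eq A lam y x -> resolvent A lam y = x.
Proof.
intros Hl Hx; destruct (proj1 Hl y) as [z [_ Hz]].
now rewrite <- (Hz x Hx), <- (Hz _ (resolvent_spec y Hl)).
Qed.

(** With [v = R(lam) x] one has [(mu - A) v = (lam - A) v + (mu - lam) v], so [v] solves the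
    equation that defines the left side. *)
Lemma resolvent_identity (X : CompleteNormedModule C_AbsRing) (A : closed_operator X) (lam mu : C) (x : X) :
  resolvent_set A lam -> resolvent_set A mu ->
  resolvent A mu (plus x (scal (Cminus mu lam : C_AbsRing) (resolvent A lam x))) = resolvent A lam x.
Proof.
intros Hl Hm; apply resolvent_unique; [easy|].
destruct (resolvent_spec x Hl) as [Hd He]; split; [easy|].
rewrite <- He at 3.
set (v := resolvent A lam x); set (w := A v).
module_coefs X; ring.
Qed.

(** The even extension turns a function given on the half-line into one continuous on the whole
    line; integrals over [[0, T]] do not see the difference. *)
Lemma continuous_on_half_line_Rabs (U : UniformSpace) (f : R -> U) (s : R) :
  continuous_on half_line f -> continuous (fun s => f (Rabs s)) s.
Proof.
intros Hf P HP.
specialize (Hf (Rabs s) (Rabs_pos s) P HP).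
change (locally s (fun s => P (f (Rabs s)))).
apply (filter_imp (fun t => half_line (Rabs t) -> P (f (Rabs t)))).
- intros t Ht; apply Ht, Rabs_pos.
- exact (continuous_Rabs s (fun y => half_line y -> P (f y)) Hf).
Qed.

Lemma cexp_RtoC (l s : R) : cexp (RtoC l) s = RtoC (exp (- (l * s))).
Proof.
unfold cexp; simpl; rewrite Rmult_0_l, cos_0, sin_0.
apply injective_projections; simpl; ring.
Qed.

Lemma norm_primitive_le (E : CompleteNormedModule R_AbsRing) (u : R -> E) (M kap t : R) :
  (forall s, continuous u s) -> 0 < kap -> 0 <= M -> 0 <= t ->
  (forall s, 0 <= s -> norm (u s) <= M * exp (kap * s)) ->
  norm (RInt u 0 t) <= M / kap * exp (kap * t).
Proof.
intros cu Hk HM Ht Hu.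
assert (I : is_RInt (fun s => M * exp (kap * s)) 0 t
  (minus (M / kap * exp (kap * t)) (M / kap * exp (kap * 0)))).
{ apply (@is_RInt_derive R_CompleteNormedModule (fun s => M / kap * exp (kap * s))
           (fun s => M * exp (kap * s))).
  - intros s _; auto_derive; trivial; field; lra.
  - intros s _; apply (ex_derive_continuous (fun s => M * exp (kap * s))).
    auto_derive; trivial. }
apply Rle_trans with (M / kap * exp (kap * t) - M / kap * exp (kap * 0)).
- refine (@norm_RInt_le E u _ 0 t _ _ Ht _ (@is_RInt_cont E u 0 t cu) I).
  intros s Hs; apply Hu; lra.
- assert (0 <= M / kap * exp (kap * 0)); [|lra].
  apply Rmult_le_pos; [|left; apply exp_pos].
  apply Rmult_le_pos; [easy|left; now apply Rinv_0_lt_compat].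
Qed.

Lemma continuous_affine (X : CompleteNormedModule C_AbsRing) (lam : C) (L : X -> X) (c1 c2 : X)
  (W U : R -> realification X) (s : R) :
  (forall s, continuous W s) -> (forall s, continuous U s) -> is_linear L ->
  continuous (fun s => minus (plus (L (U s)) c2)
       (scal (lam : C_AbsRing) (plus (L (W s)) (plus c1 (scal (RtoC s : C_AbsRing) c2))))
     : realification X) s.
Proof.
intros cW cU HL.
apply (@continuous_minus R_UniformSpace R_AbsRing (realif_NormedModule X)
  (fun s => plus (L (U s)) c2 : realification X)
  (fun s => scal (lam : C_AbsRing) (plus (L (W s)) (plus c1 (scal (RtoC s : C_AbsRing) c2)))
     : realification X)).
- apply (@continuous_plus R_UniformSpace R_AbsRing (realif_NormedModule X)
    (fun s => L (U s) : realification X)); [now apply continuous_clinear|].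
  apply (@continuous_const R_UniformSpace (realif_UniformSpace X)).
- apply (@continuous_clinear X _
    (fun s => plus (L (W s)) (plus c1 (scal (RtoC s : C_AbsRing) c2)) : realification X));
    [apply is_linear_scal_C|].
  apply (@continuous_plus R_UniformSpace R_AbsRing (realif_NormedModule X)
    (fun s => L (W s) : realification X)); [now apply continuous_clinear|].
  apply (@continuous_plus R_UniformSpace R_AbsRing (realif_NormedModule X)
    (fun s => c1 : realification X)).
  + apply (@continuous_const R_UniformSpace (realif_UniformSpace X)).
  + apply (@continuous_scal_l R_UniformSpace R_AbsRing (realif_NormedModule X) (fun s => s)).
    apply continuous_id.
Qed.

(* The resolvent identity makes the Laplace transform of the difference of the
   two sides vanish at every large real [l]. *)
Lemma integrated_semigroup_identity (X : CompleteNormedModule C_AbsRing) (A : closed_operator X)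
  (u : R -> realification X) (x : X) (mu l1 M kap : R) :
  (forall s, continuous u s) -> 0 < kap -> 0 <= M -> 0 <= l1 ->
  (forall s, 0 <= s -> norm (u s) <= M * exp (kap * s)) ->
  resolvent_set A mu -> (forall l : R, l1 < l -> resolvent_set A l) ->
  (forall l : R, l1 < l -> int_lim (fun s => scal (cexp l s : C_AbsRing) (u s : X) : realification X)
     (scal (RtoC (/ l) : C_AbsRing) (resolvent A l x) : realification X)) ->
  forall t, 0 <= t ->
  (RInt u 0 t : X) = resolvent A mu (plus (scal (RtoC t : C_AbsRing) x)
     (minus (scal (RtoC mu : C_AbsRing) (RInt u 0 t : X)) (u t : X))).
Proof.
intros cu Hk HM Hl1 Hu Hmu Hres Hlap t Ht.
pose (W := fun t => RInt u 0 t).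
change (RInt u 0 t) with (W t).
assert (DW : forall s, is_derive W s (u s)) by (intros s; now apply is_derive_primitive).
assert (cW : forall s, continuous W s).
{ intros s; apply (@ex_derive_continuous R_AbsRing (realif_NormedModule X)); eexists; apply DW. }
assert (NW : forall s, 0 <= s -> norm (W s) <= M / kap * exp (kap * s))
  by (intros s Hs; now apply norm_primitive_le).
assert (W0 : W 0 = zero) by apply (@RInt_point (realif_CompleteNormedModule X)).
pose (r := resolvent A mu).
assert (Hr : is_linear r) by apply Hmu.
destruct (linear_norm _ Hr) as [Mr [HMr Nr]].
pose (q := fun s => minus (plus (scal (RtoC s : C_AbsRing) (r x))
   (minus (scal (RtoC mu : C_AbsRing) (r (W s))) (r (u s)))) (W s : X) : realification X).
assert (cq : forall s, continuous q s).
{ intros s; unfold q.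
  apply (@continuous_minus R_UniformSpace R_AbsRing (realif_NormedModule X)); [|apply cW].
  apply (@continuous_plus R_UniformSpace R_AbsRing (realif_NormedModule X)).
  - apply (@continuous_scal_l R_UniformSpace R_AbsRing (realif_NormedModule X) (fun s => s)).
    apply continuous_id.
  - apply (@continuous_minus R_UniformSpace R_AbsRing (realif_NormedModule X)
      (fun s => scal (RtoC mu : C_AbsRing) (r (W s)) : realification X)
      (fun s => r (u s) : realification X)); [|now apply continuous_clinear].
    apply (@continuous_clinear X _ (fun s => r (W s) : realification X));
      [apply is_linear_scal_C|now apply continuous_clinear]. }
pose (Bq := Mr * norm x / kap + Rabs mu * (Mr * (M / kap)) + Mr * M + M / kap).
assert (Nq : forall s, 0 <= s -> norm (q s) <= Bq * exp (kap * s)).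
{ intros s Hs.
  assert (HMk : 0 <= M / kap) by (apply Rmult_le_pos; [easy|left; now apply Rinv_0_lt_compat]).
  assert (N1 : norm (scal (RtoC s : C_AbsRing) (r x)) <= s * (Mr * norm x)).
  { apply Rle_trans with (1 := @norm_scal C_AbsRing X _ _).
    apply Rle_trans with (Cmod (RtoC s) * norm (r x)); [apply Rle_refl|].
    rewrite Cmod_R, Rabs_pos_eq by easy; apply Rmult_le_compat_l; [easy|apply Nr]. }
  assert (N2 : norm (scal (RtoC mu : C_AbsRing) (r (W s))) <= Rabs mu * (Mr * (M / kap * exp (kap * s)))).
  { apply Rle_trans with (1 := @norm_scal C_AbsRing X _ _).
    apply Rle_trans with (Cmod (RtoC mu) * norm (r (W s))); [apply Rle_refl|].
    rewrite Cmod_R; apply Rmult_le_compat_l; [apply Rabs_pos|].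
    apply Rle_trans with (1 := Nr _), Rmult_le_compat_l; [lra|now apply NW]. }
  assert (N3 : norm (r (u s)) <= Mr * (M * exp (kap * s))).
  { apply Rle_trans with (1 := Nr _), Rmult_le_compat_l; [lra|now apply Hu]. }
  assert (X1 : s <= / kap * exp (kap * s)).
  { apply Rmult_le_reg_l with kap; [easy|]; rewrite <- Rmult_assoc, Rinv_r by lra.
    pose proof (exp_ineq1_le (kap * s)); lra. }
  assert (P1 := @norm_ge_0 C_AbsRing X x).
  assert (N1' : s * (Mr * norm x) <= / kap * exp (kap * s) * (Mr * norm x)).
  { apply Rmult_le_compat_r; [apply Rmult_le_pos; lra|easy]. }
  apply Rle_trans with (norm (scal (RtoC s : C_AbsRing) (r x)) +
    (norm (scal (RtoC mu : C_AbsRing) (r (W s))) + norm (r (u s))) + norm (W s)).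
  - unfold q, minus at 1; apply Rle_trans with (1 := @norm_triangle C_AbsRing X _ _).
    apply Rplus_le_compat; [|apply Req_le, (@norm_opp C_AbsRing X)].
    apply Rle_trans with (1 := @norm_triangle C_AbsRing X _ _), Rplus_le_compat_l.
    apply Rle_trans with (1 := @norm_triangle C_AbsRing X _ _), Rplus_le_compat_l.
    apply Req_le, (@norm_opp C_AbsRing X).
  - specialize (NW s Hs).
    replace (Bq * exp (kap * s)) with (/ kap * exp (kap * s) * (Mr * norm x) +
      (Rabs mu * (Mr * (M / kap * exp (kap * s))) + Mr * (M * exp (kap * s))) +
      M / kap * exp (kap * s)) by (unfold Bq; field; lra).
    apply Rplus_le_compat; [|exact NW].
    apply Rplus_le_compat; [lra|now apply Rplus_le_compat]. }
assert (HBq : 0 <= Bq).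
{ specialize (Nq 0 (Rle_refl 0)); rewrite Rmult_0_r, exp_0, Rmult_1_r in Nq.
  apply Rle_trans with (2 := Nq), norm_ge_0. }
assert (Lq : forall l : R, Rmax l1 kap < l ->
  int_lim (fun s => scal (cexp l s : C_AbsRing) (q s : X) : realification X) zero).
{ intros l Hl.
  pose proof (Rmax_l l1 kap); pose proof (Rmax_r l1 kap).
  assert (Hl0 : RtoC l <> RtoC 0) by (intros E; apply RtoC_inj in E; lra).
  pose (RL := resolvent A l x).
  (* [L], [c1], [c2] are determined by the terms of [q] in [W] and [s], and [K] supplies the rest in
     [u]: [cexp l s] times [q] is [K (cexp l s u)] minus the integrand of [laplace_affine]. *)
  pose (K := fun w : X => plus (scal (Cminus (Cdiv mu l) 1 : C_AbsRing) (r w))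
                               (scal (Copp (Cinv l) : C_AbsRing) w)).
  pose (L := fun w : X => plus (scal (Cdiv mu l : C_AbsRing) (r w))
                               (scal (Copp (Cinv l) : C_AbsRing) w)).
  assert (HK : is_linear K) by now apply is_linear_comb.
  assert (HL : is_linear L) by now apply is_linear_comb.
  pose (c1 := scal (Cdiv 1 (Cmult l l) : C_AbsRing) (r x)).
  pose (c2 := scal (Cdiv 1 l : C_AbsRing) (r x)).
  assert (Hkl : 0 <= kap < Re (RtoC l)) by (unfold Re, RtoC; simpl; lra).
  assert (I1 := @laplace_affine X l L c1 c2 W u kap (M / kap) DW cu HL Hkl W0 NW).
  assert (I2 := int_lim_clinear HK (fun s => @continuous_cexp_scal X l u s (cu s)) (Hlap l ltac:(lra))).
  assert (I3 := int_lim_clinear (is_linear_scal_C X (Copp 1))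
    (fun s => @continuous_cexp_scal X l _ s (@continuous_affine X l L c1 c2 W u s cW cu HL)) I1).
  assert (cI2 : forall s, continuous (fun s => K (scal (cexp l s : C_AbsRing) (u s : X)) : realification X) s).
  { intros s; apply (@continuous_clinear X K (fun s => scal (cexp l s : C_AbsRing) (u s : X) : realification X));
      [easy|now apply continuous_cexp_scal]. }
  assert (cI3 : forall s, continuous (fun s => scal (Copp 1 : C_AbsRing) (scal (cexp l s : C_AbsRing)
     (minus (plus (L (u s)) c2)
       (scal (RtoC l : C_AbsRing) (plus (L (W s)) (plus c1 (scal (RtoC s : C_AbsRing) c2)))))) : realification X) s).
  { intros s; apply (@continuous_clinear X _ (fun s => (scal (cexp l s : C_AbsRing)
     (minus (plus (L (u s)) c2)
       (scal (RtoC l : C_AbsRing) (plus (L (W s)) (plus c1 (scal (RtoC s : C_AbsRing) c2)))))) : realification X));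
      [apply is_linear_scal_C|apply continuous_cexp_scal; now apply continuous_affine]. }
  assert (I4 := int_lim_plus cI2 cI3 I2 I3).
  refine (@eq_ind (realification X) _ (fun J => int_lim _ J) _ _ _).
  - refine (int_lim_ext _ I4); intros s _.
    unfold q.
    change (plus (K (scal (cexp l s : C_AbsRing) (u s : X)))
      (scal (Copp 1 : C_AbsRing) (scal (cexp l s : C_AbsRing)
       (minus (plus (L (u s)) c2)
       (scal (RtoC l : C_AbsRing) (plus (L (W s)) (plus c1 (scal (RtoC s : C_AbsRing) c2))))))) =
      scal (cexp l s : C_AbsRing) (minus (plus (scal (RtoC s : C_AbsRing) (r x))
   (minus (scal (RtoC mu : C_AbsRing) (r (W s))) (r (u s)))) (W s : X))).
    rewrite (linear_scal _ HK); unfold K, L, c1, c2.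
    set (e := cexp l s); set (w := W s : X); set (rw := r w); set (v := u s : X); set (rv := r v); set (rx := r x).
    module_coefs X; field; auto.
  - change (plus (K (scal (RtoC (/ l) : C_AbsRing) RL)) (scal (Copp 1 : C_AbsRing) (opp c1)) = (zero : X)).
    rewrite (linear_scal _ HK); unfold K, c1.
    (* The limit is [1 / l^2] times the defect of this resolvent identity, hence zero. *)
    assert (Rid : plus (r x) (scal (Cminus mu l : C_AbsRing) (r RL)) = RL).
    { rewrite <- (linear_scal _ Hr), <- (linear_plus _ Hr).
      apply resolvent_identity; [apply Hres; lra|easy]. }
    transitivity (scal (Cdiv 1 (Cmult l l) : C_AbsRing)
      (minus (plus (r x) (scal (Cminus mu l : C_AbsRing) (r RL))) RL)).
    + set (rr := r RL); set (rx := r x).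
      rewrite RtoC_inv by lra.
      module_coefs X; field; auto.
    + rewrite Rid; module_coefs X; ring. }
(* [laplace_injective] needs a bounded function; the factor shifts the Laplace variable by [kap]. *)
pose (f := fun s => scal (exp (- (kap * s))) (q s)).
assert (cf : forall s, continuous f s).
{ intros s; apply (@continuous_scal R_UniformSpace R_AbsRing (realif_NormedModule X)
    (fun s => exp (- (kap * s)))); [|apply cq].
  apply (ex_derive_continuous (fun s => exp (- (kap * s)))); auto_derive; trivial. }
assert (Zf : f t = zero).
{ apply (@laplace_injective (realif_CompleteNormedModule X) f Bq (Rmax l1 kap) t); auto.
  - intros s Hs; apply Rle_trans with (1 := @norm_scal R_AbsRing (realif_NormedModule X) _ _).
    change (abs (exp (- (kap * s)))) with (Rabs (exp (- (kap * s)))).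
    rewrite Rabs_pos_eq by (left; apply exp_pos).
    replace Bq with (exp (- (kap * s)) * (Bq * exp (kap * s))).
    + apply Rmult_le_compat_l; [left; apply exp_pos|now apply Nq].
    + rewrite Rmult_comm, Rmult_assoc, <- exp_plus, Rplus_opp_r, exp_0; ring.
  - intros l Hl.
    pose proof (Rmax_l l1 kap).
    assert (I := int_lim_int_le (Lq (l + kap) ltac:(lra))).
    apply int_le_mono with (norm (zero : realification X)).
    { apply Req_le, (@norm_zero R_AbsRing (realif_NormedModule X)). }
    apply int_le_ext with (2 := I).
    intros s _; unfold f.
    rewrite cexp_RtoC, (@scal_assoc R_Ring (realif_ModuleSpace X)).
    change (scal (RtoC (exp (- ((l + kap) * s))) : C_AbsRing) (q s : X) =
      scal (RtoC (exp (- (l * s)) * exp (- (kap * s))) : C_AbsRing) (q s : X)).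
    rewrite <- exp_plus; do 3 f_equal; ring. }
assert (Zq : q t = zero).
{ transitivity (scal (exp (kap * t)) (f t)).
  - unfold f; rewrite (@scal_assoc R_Ring (realif_ModuleSpace X)).
    change (q t = scal (exp (kap * t) * exp (- (kap * t))) (q t)).
    rewrite <- exp_plus, Rplus_opp_r, exp_0; symmetry; exact (@scal_one R_Ring (realif_ModuleSpace X) (q t)).
  - rewrite Zf; apply (@scal_zero_r R_Ring (realif_ModuleSpace X)). }
fold r; unfold minus.
rewrite !(linear_plus _ Hr), (linear_opp _ _ Hr), !(linear_scal _ Hr).
transitivity (plus (W t : X) (q t : X)).
- rewrite Zq; symmetry; apply (@plus_zero_r X).
- unfold q; set (w := W t : X); set (rw := r w); set (v := u t : X); set (rv := r v); set (rx := r x).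
  module_coefs X; ring.
Qed.

(** [mu] and the reals above [l1] establish the relation between [A] and the primitive of [u]; the
    parameter [lam] enters afterwards, through algebra only. *)
Lemma laplace_resolvent (X : CompleteNormedModule C_AbsRing) (A : closed_operator X)
  (u : R -> realification X) (x : X) (mu l1 M kap : R) (lam : C) :
  (forall s, continuous u s) -> 0 < kap -> 0 <= M -> 0 <= l1 ->
  (forall s, 0 <= s -> norm (u s) <= M * exp (kap * s)) ->
  resolvent_set A mu -> (forall l : R, l1 < l -> resolvent_set A l) ->
  (forall l : R, l1 < l -> int_lim (fun s => scal (cexp l s : C_AbsRing) (u s : X) : realification X)
     (scal (RtoC (/ l) : C_AbsRing) (resolvent A l x) : realification X)) ->
  kap < Re lam -> resolvent_set A lam ->
  int_lim (fun s => scal (cexp lam s : C_AbsRing) (u s : X) : realification X)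
     (scal (Cinv lam : C_AbsRing) (resolvent A lam x) : realification X).
Proof.
intros cu Hk HM Hl1 Hu Hmu Hres Hlap Hlam Hrl.
assert (Hid := integrated_semigroup_identity cu Hk HM Hl1 Hu Hmu Hres Hlap).
pose (W := fun t => RInt u 0 t).
assert (DW : forall s, is_derive W s (u s)) by (intros s; now apply is_derive_primitive).
assert (cW : forall s, continuous W s).
{ intros s; apply (@ex_derive_continuous R_AbsRing (realif_NormedModule X)); eexists; apply DW. }
assert (NW : forall s, 0 <= s -> norm (W s) <= M / kap * exp (kap * s))
  by (intros s Hs; now apply norm_primitive_le).
assert (W0 : W 0 = zero) by apply (@RInt_point (realif_CompleteNormedModule X)).
pose (r := resolvent A lam).
assert (Hr : is_linear r) by apply Hrl.
assert (Hl0 : lam <> RtoC 0) by (intros ->; simpl in Hlam; lra).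
(* [A W(s) = u(s) - s x] no longer mentions [mu], so it can be solved again at [lam]. *)
assert (HW : forall s, 0 <= s -> plus (scal (lam : C_AbsRing) (r (W s)))
   (plus (opp (r (u s))) (scal (RtoC s : C_AbsRing) (r x))) = W s).
{ intros s Hs.
  transitivity (r (plus (scal (lam : C_AbsRing) (W s : X))
     (plus (opp (u s : X)) (scal (RtoC s : C_AbsRing) x)))).
  { now rewrite !(linear_plus _ Hr), (linear_opp _ _ Hr), !(linear_scal _ Hr). }
  apply resolvent_unique; [easy|].
  destruct (resolvent_spec (plus (scal (RtoC s : C_AbsRing) x)
     (minus (scal (RtoC mu : C_AbsRing) (RInt u 0 s : X)) (u s : X))) Hmu) as [Hd He].
  rewrite <- (Hid s Hs) in Hd, He; split; [exact Hd|].
  change (RInt u 0 s) with (W s) in He.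
  set (w := W s : X) in *; set (v := u s : X) in *.
  transitivity (plus (scal (Cminus lam mu : C_AbsRing) w) (minus (scal (RtoC mu : C_AbsRing) w) (A w))).
  - set (aw := A w); module_coefs X; ring.
  - rewrite He; module_coefs X; ring. }
(* By [HW] the primitive [cexp lam s (L (W s) + c1 + s c2)] equals [- cexp lam s r (x + lam u(s))]
   for [s >= 0]. It is written through [W] since [u] is not known to be differentiable. *)
pose (L := fun w : X => plus (scal (Copp (Cmult lam lam) : C_AbsRing) (r w))
                             (scal (lam : C_AbsRing) w)).
assert (HL : is_linear L) by now apply is_linear_comb.
pose (c1 := opp (r x)).
pose (c2 := scal (Copp lam : C_AbsRing) (r x)).
assert (I1 := @laplace_affine X lam L c1 c2 W u kap (M / kap) DW cu HL (conj (Rlt_le _ _ Hk) Hlam) W0 NW).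
assert (I2 := int_lim_clinear (is_linear_scal_C X (Cinv lam))
    (fun s => @continuous_cexp_scal X lam _ s (@continuous_affine X lam L c1 c2 W u s cW cu HL)) I1).
refine (@eq_ind (realification X) _ (fun J => int_lim _ J) _ _ _).
- refine (int_lim_ext _ I2); intros s Hs.
  specialize (HW s (Rlt_le _ _ Hs)); revert HW; unfold L, c1, c2.
  change (RInt u 0 s) with (W s).
  set (e := cexp lam s); set (w := W s : X); set (rw := r w); set (v := u s : X); set (rv := r v); set (rx := r x).
  intros HW.
  transitivity (plus (scal (e : C_AbsRing) v) (scal (Cmult e lam : C_AbsRing)
    (minus (plus (scal (lam : C_AbsRing) rw) (plus (opp rv) (scal (RtoC s : C_AbsRing) rx))) w))).
  + module_coefs X; field; auto.
  + rewrite HW; module_coefs X; ring.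
- change (scal (Cinv lam : C_AbsRing) (opp (opp (r x))) = scal (Cinv lam : C_AbsRing) (r x)).
  now rewrite opp_opp.
Qed.

(** The exponent [c] is split as [(c - 1) + 1]: the first part makes [N] bounded, the second is the
    weight [exp (- s)] of the Fejer argument. Restoring the first part turns [exp (t + 1)] into
    [exp 1 * exp (c t)]. *)
Lemma laplace_inversion_bound (X : CompleteNormedModule C_AbsRing) (N : R -> realification X)
  (c b eps B t : R) :
  (forall s, continuous N s) -> 0 <= B ->
  (forall s, 0 <= s -> norm (N s) <= B * exp ((c - 1) * s)) ->
  0 < b -> 0 <= eps ->
  (forall sg : R, exists Z : realification X,
     int_lim (fun s => scal (cexp (c, sg) s : C_AbsRing) (N s : X) : realification X) Z /\
     norm Z <= eps * Rpower (1 + Rabs sg) (- (1 + b))) ->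
  0 <= t -> norm (N t) <= 2 * exp 1 * (eps * (1 + 2 / b)) * exp (c * t).
Proof.
intros cN HB HN Hb Heps HZ Ht.
pose (f := fun s => scal (exp (- ((c - 1) * s))) (N s)).
assert (cf : forall s, continuous f s).
{ intros s; apply (@continuous_scal R_UniformSpace R_AbsRing (realif_NormedModule X)
    (fun s => exp (- ((c - 1) * s)))); [|apply cN].
  apply (ex_derive_continuous (fun s => exp (- ((c - 1) * s)))); auto_derive; trivial. }
assert (F : norm (f t) <= 2 * exp (t + 1) * (eps * (1 + 2 / b))).
{ apply (@fejer_inversion (realif_CompleteNormedModule X) f B t b eps); auto.
  - intros s Hs; apply Rle_trans with (1 := @norm_scal R_AbsRing (realif_NormedModule X) _ _).
    change (abs (exp (- ((c - 1) * s)))) with (Rabs (exp (- ((c - 1) * s)))).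
    rewrite Rabs_pos_eq by (left; apply exp_pos).
    replace B with (exp (- ((c - 1) * s)) * (B * exp ((c - 1) * s))).
    + apply Rmult_le_compat_l; [left; apply exp_pos|now apply HN].
    + rewrite Rmult_comm, Rmult_assoc, <- exp_plus, Rplus_opp_r, exp_0; ring.
  - intros sg Hsg.
    destruct (HZ sg) as [Z1 [L1 B1]]; destruct (HZ (- sg)) as [Z2 [L2 B2]].
    rewrite Rabs_Ropp in B2; rewrite Rabs_pos_eq in B1, B2 by easy.
    (* [k1] is [exp (i sg t) / 2] and [k2] its conjugate: applied to the frequencies [sg] and [- sg]
       they produce [cos (sg (s - t))]. *)
    pose (k1 := ((cos (sg * t) / 2, sin (sg * t) / 2) : C)).
    pose (k2 := ((cos (sg * t) / 2, - (sin (sg * t) / 2)) : C)).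
    assert (C1 : Cmod k1 = 1 / 2 /\ Cmod k2 = 1 / 2).
    { assert (EE := sin2_cos2 (sg * t)); unfold Rsqr in EE.
      unfold Cmod, k1, k2; simpl; split.
      - replace (_ + _) with ((1 / 2) ^ 2) by nra; apply sqrt_pow2; lra.
      - replace (_ + _) with ((1 / 2) ^ 2) by nra; apply sqrt_pow2; lra. }
    assert (cE : forall k l s, continuous (fun s => scal (k : C_AbsRing)
       (scal (cexp l s : C_AbsRing) (N s : X)) : realification X) s).
    { intros k l s; apply (@continuous_clinear X _
         (fun s => scal (cexp l s : C_AbsRing) (N s : X) : realification X));
        [apply is_linear_scal_C|now apply continuous_cexp_scal]. }
    assert (I1 := int_lim_clinear (is_linear_scal_C X k1)
      (fun s => @continuous_cexp_scal X (c, sg) N s (cN s)) L1).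
    assert (I2 := int_lim_clinear (is_linear_scal_C X k2)
      (fun s => @continuous_cexp_scal X (c, - sg) N s (cN s)) L2).
    assert (I := int_lim_plus (cE k1 (c, sg)) (cE k2 (c, - sg)) I1 I2).
    apply int_lim_int_le in I.
    apply int_le_mono with (e := eps * Rpower (1 + sg) (- (1 + b))) in I.
    + apply int_le_ext with (2 := I); intros s _; unfold f.
      rewrite (@scal_assoc R_Ring (realif_ModuleSpace X)).
      change (plus (scal (k1 : C_AbsRing) (scal (cexp (c, sg) s : C_AbsRing) (N s : X)))
         (scal (k2 : C_AbsRing) (scal (cexp (c, - sg) s : C_AbsRing) (N s : X))) =
        scal (RtoC (cos (sg * (s - t)) * exp (- s) * exp (- ((c - 1) * s))) : C_AbsRing) (N s : X)).
      set (v := N s : X).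
      assert (EE : exp (- (c * s)) = exp (- s) * exp (- ((c - 1) * s)))
        by (rewrite <- exp_plus; f_equal; ring).
      module_coefs X.
      unfold cexp; cbn [Re Im fst snd]; rewrite EE, Rmult_minus_distr_l, cos_minus.
      rewrite Ropp_mult_distr_l_reverse, cos_neg, sin_neg.
      apply injective_projections; simpl; field.
    + apply Rle_trans with (1 := @norm_triangle C_AbsRing X _ _).
      apply Rle_trans with (1 / 2 * norm Z1 + 1 / 2 * norm Z2); [|lra].
      apply Rplus_le_compat.
      * rewrite <- (proj1 C1); exact (@norm_scal C_AbsRing X k1 Z1).
      * rewrite <- (proj2 C1); exact (@norm_scal C_AbsRing X k2 Z2). }
replace (N t) with (scal (exp ((c - 1) * t)) (f t)).
- apply Rle_trans with (1 := @norm_scal R_AbsRing (realif_NormedModule X) _ _).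
  change (abs (exp ((c - 1) * t))) with (Rabs (exp ((c - 1) * t))).
  rewrite Rabs_pos_eq by (left; apply exp_pos).
  replace (2 * exp 1 * (eps * (1 + 2 / b)) * exp (c * t)) with
    (exp ((c - 1) * t) * (2 * exp (t + 1) * (eps * (1 + 2 / b)))).
  + apply Rmult_le_compat_l; [left; apply exp_pos|exact F].
  + replace (c * t) with ((c - 1) * t + t) by ring; rewrite !exp_plus; ring.
- unfold f; rewrite (@scal_assoc R_Ring (realif_ModuleSpace X)).
  change (scal (exp ((c - 1) * t) * exp (- ((c - 1) * t))) (N t) = N t).
  rewrite <- exp_plus, Rplus_opp_r, exp_0; exact (@scal_one R_Ring (realif_ModuleSpace X) (N t)).
Qed.

(** * Suprema, operator norms and moderate sequences *)

Lemma sup_over_ub (T : Type) (D : T -> Prop) (f : T -> R) (t : T) :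
  D t -> Rbar_le (f t) (sup_over D f).
Proof.
intros Ht; apply (Lub_Rbar_correct (fun r => exists t, D t /\ r = f t)); now exists t.
Qed.

Lemma sup_over_le (T : Type) (D : T -> Prop) (f : T -> R) (c : R) :
  (forall t, D t -> f t <= c) -> Rbar_le (sup_over D f) c.
Proof.
intros H; apply (Lub_Rbar_correct (fun r => exists t, D t /\ r = f t)).
intros r [t [Ht ->]]; now apply H.
Qed.

Lemma sup_over_finite (T : Type) (D : T -> Prop) (f : T -> R) (c : R) (t : T) :
  D t -> (forall t, D t -> f t <= c) -> is_finite (sup_over D f).
Proof.
intros Ht H; assert (H1 := sup_over_ub f Ht); assert (H2 := sup_over_le H).
now destruct (sup_over D f).
Qed.

(** The norm axiom is an inequality; using it for [/ a] as well gives the converse. *)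
Lemma norm_scal_RtoC (X : CompleteNormedModule C_AbsRing) (a : R) (v : X) : 0 < a ->
  norm (scal (RtoC a : C_AbsRing) v) = a * norm v.
Proof.
intros Ha.
assert (U : forall (a : R) (v : X), 0 < a -> norm (scal (RtoC a : C_AbsRing) v) <= a * norm v).
{ clear; intros a v Ha; apply Rle_trans with (1 := @norm_scal C_AbsRing X _ _), Req_le.
  transitivity (Cmod (RtoC a) * norm v); [reflexivity|now rewrite Cmod_R, Rabs_pos_eq by lra]. }
apply Rle_antisym; [now apply U|].
apply Rmult_le_reg_l with (/ a); [now apply Rinv_0_lt_compat|].
rewrite <- Rmult_assoc, Rinv_l, Rmult_1_l by lra.
apply Rle_trans with (2 := U (/ a) _ (Rinv_0_lt_compat _ Ha)), Req_le; f_equal.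
rewrite RtoC_inv by lra; module_coefs X; field.
intros E; apply RtoC_inj in E; lra.
Qed.

Lemma norm_le_opnorm (X : CompleteNormedModule C_AbsRing) (T : X -> X) (x : X) :
  is_linear T -> norm (T x) <= opnorm T * norm x.
Proof.
intros HT; destruct (linear_norm _ HT) as [M [HM HN]].
(* [opnorm] takes the [real] part of a supremum, which would be 0 at infinity; boundedness of [T]
   excludes that. *)
assert (Hfin : is_finite (sup_over (fun x : X => norm x <= 1) (fun x => norm (T x)))).
{ apply sup_over_finite with (c := M) (t := zero).
  - apply Rle_trans with 0; [apply Req_le, (@norm_zero C_AbsRing X)|lra].
  - intros y Hy; apply Rle_trans with (1 := HN y).
    rewrite <- (Rmult_1_r M) at 2; apply Rmult_le_compat_l; lra. }
destruct (Req_dec (norm x) 0) as [Hx|Hx].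
- rewrite Hx, Rmult_0_r; apply Rle_trans with (1 := HN x); rewrite Hx; lra.
- assert (Hx0 : 0 < norm x) by (pose proof (@norm_ge_0 C_AbsRing X x); lra).
  pose (y := scal (RtoC (/ norm x) : C_AbsRing) x).
  assert (Hy : norm y <= 1).
  { unfold y; rewrite norm_scal_RtoC by now apply Rinv_0_lt_compat.
    rewrite Rinv_l by easy; lra. }
  assert (H1 := @sup_over_ub X (fun x => norm x <= 1) (fun x => norm (T x)) y Hy).
  rewrite <- Hfin in H1; change (norm (T y) <= opnorm T) in H1.
  unfold y in H1; rewrite (linear_scal _ HT), norm_scal_RtoC in H1 by now apply Rinv_0_lt_compat.
  apply Rmult_le_compat_l with (r := norm x) in H1; [|lra].
  rewrite <- Rmult_assoc, Rinv_r, Rmult_1_l in H1 by easy; lra.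
Qed.

Lemma exp_sup_op_bound (X : CompleteNormedModule C_AbsRing) (S : R -> X -> X) (w t : R) (x : X) :
  is_finite (exp_sup_op w S) -> (forall t, half_line t -> is_linear (S t)) -> 0 <= t ->
  norm (S t x) <= real (exp_sup_op w S) * norm x * exp (w * t).
Proof.
intros Hfin HS Ht.
pose (T := fun x => scal (RtoC (exp (- w * t)) : C_AbsRing) (S t x)).
assert (HT : is_linear T).
{ destruct (HS t Ht) as [Hp Hs [M [HM HN]]]; constructor; unfold T.
  - intros a b; rewrite Hp; module_coefs X; ring.
  - intros k a; rewrite Hs; module_coefs X; ring.
  - exists (exp (- w * t) * M); split; [apply Rmult_lt_0_compat; [apply exp_pos|easy]|].
    intros a; rewrite norm_scal_RtoC by apply exp_pos.
    rewrite Rmult_assoc; apply Rmult_le_compat_l; [left; apply exp_pos|apply HN]. }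
assert (H1 := norm_le_opnorm x HT); unfold T at 1 in H1.
rewrite norm_scal_RtoC in H1 by apply exp_pos.
assert (H2 := @sup_over_ub R half_line (fun t => opnorm
  (fun x => scal (RtoC (exp (- w * t)) : C_AbsRing) (S t x))) t Ht).
change (Rbar_le (opnorm T) (exp_sup_op w S)) in H2.
rewrite <- Hfin in H2; simpl in H2.
assert (H3 : exp (- w * t) * norm (S t x) <= real (exp_sup_op w S) * norm x).
{ apply Rle_trans with (1 := H1); apply Rmult_le_compat_r; [apply norm_ge_0|easy]. }
apply Rmult_le_reg_l with (exp (- w * t)); [apply exp_pos|].
apply Rle_trans with (1 := H3), Req_le.
transitivity (real (exp_sup_op w S) * norm x * (exp (- w * t) * exp (w * t))); [|ring].
rewrite <- exp_plus; replace (- w * t + w * t) with 0 by ring; rewrite exp_0; ring.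
Qed.

Lemma exp_sup_op_nonneg (X : CompleteNormedModule C_AbsRing) (S : R -> X -> X) (w : R) :
  is_finite (exp_sup_op w S) -> (forall t, half_line t -> is_linear (S t)) ->
  0 <= real (exp_sup_op w S).
Proof.
intros Hfin HS.
assert (H0 : half_line 0) by apply Rle_refl.
pose (T := fun x : X => scal (RtoC (exp (- w * 0)) : C_AbsRing) (S 0 x)).
assert (H2 := @sup_over_ub R half_line (fun t => opnorm
  (fun x => scal (RtoC (exp (- w * t)) : C_AbsRing) (S t x))) 0 H0).
rewrite <- Hfin in H2; apply Rle_trans with (2 := H2).
assert (H3 := @sup_over_ub X (fun x => norm x <= 1)
  (fun x => norm (scal (RtoC (exp (- w * 0)) : C_AbsRing) (S 0 x))) zero).
(* If the supremum were infinite, its [real] part would be 0, which is nonnegative too. *)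
unfold opnorm; destruct sup_over as [r| |]; simpl in *.
- apply Rle_trans with (2 := H3 ltac:(apply Rle_trans with 0; [apply Req_le, (@norm_zero C_AbsRing X)|lra])), norm_ge_0.
- lra.
- lra.
Qed.

(** * Polynomially bounded sequences *)

Lemma poly_bounded_le (u v : nat -> Rbar) :
  (forall n, Rbar_le (u n) (v n)) -> poly_bounded v -> poly_bounded u.
Proof.
intros H [a [c Hc]]; exists a, c; apply filter_imp with (2 := Hc).
intros n Hn; now apply Rbar_le_trans with (v n).
Qed.

Lemma Rpower_INR_le (n : nat) (a b : R) : (1 <= n)%nat -> a <= b ->
  Rpower (INR n) a <= Rpower (INR n) b.
Proof. intros Hn Hab; apply le_INR in Hn; simpl in Hn; now apply Rle_Rpower. Qed.

Lemma poly_bounded_plus (u v : nat -> R) :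
  poly_bounded (fun n => Finite (u n)) -> poly_bounded (fun n => Finite (v n)) ->
  poly_bounded (fun n => Finite (u n + v n)).
Proof.
intros [a1 [c1 H1]] [a2 [c2 H2]].
(* The constants may be negative, hence the absolute values; raising the exponent to the maximum
   needs a base of at least 1, hence [1 <= n] below. *)
exists (Rmax a1 a2), (Rabs c1 + Rabs c2).
assert (H : eventually (fun n => (1 <= n)%nat)) by now exists 1%nat.
apply filter_imp with (2 := filter_and _ _ H (filter_and _ _ H1 H2)); simpl.
intros n [Hn [Hu Hv]]; rewrite Rmult_plus_distr_r.
assert (W : forall c a, a <= Rmax a1 a2 ->
  c * Rpower (INR n) a <= Rabs c * Rpower (INR n) (Rmax a1 a2)).
{ intros c a Ha; pose proof (Rpower_INR_le Hn Ha).
  assert (0 < Rpower (INR n) a) by apply exp_pos.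
  pose proof (Rle_abs c); pose proof (Rabs_pos c); nra. }
pose proof (W c1 a1 (Rmax_l _ _)); pose proof (W c2 a2 (Rmax_r _ _)); lra.
Qed.

Lemma poly_bounded_mult (u v : nat -> R) : (forall n, 0 <= u n) -> (forall n, 0 <= v n) ->
  poly_bounded (fun n => Finite (u n)) -> poly_bounded (fun n => Finite (v n)) ->
  poly_bounded (fun n => Finite (u n * v n)).
Proof.
intros Hu0 Hv0 [a1 [c1 H1]] [a2 [c2 H2]].
exists (a1 + a2), (c1 * c2).
apply filter_imp with (2 := filter_and _ _ H1 H2); simpl.
intros n [Hu Hv]; rewrite Rpower_plus.
replace (c1 * c2 * (Rpower (INR n) a1 * Rpower (INR n) a2)) with
  ((c1 * Rpower (INR n) a1) * (c2 * Rpower (INR n) a2)) by ring.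
now apply Rmult_le_compat.
Qed.

Lemma poly_bounded_const (c : R) : poly_bounded (fun _ => Finite c).
Proof.
exists 0, c, 1%nat; intros n Hn; simpl.
apply Req_le; unfold Rpower; rewrite Rmult_0_l, exp_0; ring.
Qed.

Lemma moderate_comb (X : CompleteNormedModule C_AbsRing) (k l : C) (x y : nat -> X) :
  moderate x -> moderate y ->
  moderate (fun n => plus (scal (k : C_AbsRing) (x n)) (scal (l : C_AbsRing) (y n))).
Proof.
intros Hx Hy.
assert (W : forall (k : C) (z : nat -> X), moderate z ->
  poly_bounded (fun n => Finite (Cmod k * norm (z n)))).
{ intros c z Hz; apply poly_bounded_mult; [intros; apply Cmod_ge_0|intros; apply norm_ge_0| |exact Hz].
  apply poly_bounded_const. }
apply poly_bounded_le with (2 := poly_bounded_plus (W k x Hx) (W l y Hy)).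
intros n; simpl; apply Rle_trans with (1 := @norm_triangle C_AbsRing X _ _).
apply Rplus_le_compat; apply (@norm_scal C_AbsRing X).
Qed.

Lemma resolvent_range (X : CompleteNormedModule C_AbsRing) (A : closed_operator X) (lam : C) (x : X) :
  resolvent_set A lam -> (exists y, resolvent A lam y = x) <-> dom A x.
Proof.
intros Hl; split.
- intros [y <-]; apply (resolvent_spec y Hl).
- intros Hx; exists (minus (scal (lam : C_AbsRing) x) (A x)); now apply resolvent_unique.
Qed.

(** The preimage of [x] under the resolvent is [lam x - A x]; for moderate [x] it is moderate
    exactly when [A x] is. The sequence condition on ranges thus becomes one on domains. *)
Lemma seq_range_seq_dom (X : CompleteNormedModule C_AbsRing) (A : nat -> closed_operator X)
  (lam : R) (x : nat -> X) :
  (forall n, resolvent_set (A n) lam) -> seq_range A lam x <-> seq_dom A x.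
Proof.
intros Hl; split; intros [Hx H]; split; trivial.
- destruct H as [y [Hy Hyx]].
  assert (Hs : forall n, resolvent_eq (A n) lam (y n) (x n)).
  { intros n; rewrite <- Hyx; now apply resolvent_spec. }
  split; [intros n; apply Hs|].
  apply poly_bounded_le with (2 := @moderate_comb X lam (Copp 1) x y Hx Hy).
  intros n; apply Req_le; f_equal; destruct (Hs n) as [_ <-].
  set (a := A n (x n)); module_coefs X; ring.
- destruct H as [Hd HA]; exists (fun n => minus (scal (RtoC lam : C_AbsRing) (x n)) (A n (x n))); split.
  + apply poly_bounded_le with (2 := @moderate_comb X lam (Copp 1) x _ Hx HA).
    intros n; apply Req_le; f_equal.
    set (a := A n (x n)); module_coefs X; ring.
  + intros n; apply resolvent_unique; [apply Hl|now split].
Qed.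

Lemma Cmod_Cpower (z : C) (b : R) : Cmod (Cpower z b) = Rpower (Cmod z) b.
Proof.
unfold Cpower; rewrite Cmod_mult, Cmod_R, Rabs_pos_eq by (left; apply exp_pos).
rewrite <- (Rmult_1_r (Rpower (Cmod z) b)) at 2; f_equal.
unfold Cmod; simpl.
replace (_ + _) with ((sin (b * Carg z))² + (cos (b * Carg z))²) by (unfold Rsqr; ring).
now rewrite sin2_cos2, sqrt_1.
Qed.

(** Passes from the weight in (GE4) to decay along a vertical line. Both 1 and [Rabs (Im lam)] are
    at most [Cmod lam], so [Cmod lam] dominates half of their sum; this half is the source of
    [Rpower 2 (1 + b)]. *)
Lemma norm_le_of_Cpower (X : CompleteNormedModule C_AbsRing) (lam : C) (b d : R) (v : X) :
  1 <= Re lam -> 0 < b -> norm (scal (Cpower lam b : C_AbsRing) v) <= d ->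
  norm (scal (Cinv lam : C_AbsRing) v) <=
    d * Rpower 2 (1 + b) * Rpower (1 + Rabs (Im lam)) (- (1 + b)).
Proof.
intros Hl Hb Hd.
assert (Hre : 1 <= Cmod lam).
{ apply Rle_trans with (2 := re_le_Cmod lam); now rewrite Rabs_pos_eq by lra. }
assert (Hm : (1 + Rabs (Im lam)) / 2 <= Cmod lam).
{ pose proof (Rmax_Cmod lam); pose proof (Rmax_r (Rabs (fst lam)) (Rabs (snd lam))).
  unfold Im; lra. }
assert (Hl0 : lam <> RtoC 0) by (intros ->; rewrite Cmod_0 in Hre; lra).
assert (Hp : Cmod (Cpower lam b) = Rpower (Cmod lam) b) by apply Cmod_Cpower.
assert (Hp0 : Cpower lam b <> RtoC 0).
{ intros E; rewrite E, Cmod_0 in Hp; pose proof (exp_pos (b * ln (Cmod lam))).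
  unfold Rpower in Hp; lra. }
pose (w := scal (Cpower lam b : C_AbsRing) v).
assert (Hd0 : 0 <= d) by (apply Rle_trans with (2 := Hd), norm_ge_0).
apply Rle_trans with (Rpower (Cmod lam) (- (1 + b)) * d).
- apply Rle_trans with (norm (scal (Cinv (Cmult lam (Cpower lam b)) : C_AbsRing) w)).
  { apply Req_le; f_equal; unfold w; module_coefs X; field; auto. }
  apply Rle_trans with (1 := @norm_scal C_AbsRing X _ _).
  apply Rmult_le_compat; [apply Cmod_ge_0|apply norm_ge_0| |exact Hd].
  apply Req_le.
  transitivity (Cmod (Cinv (Cmult lam (Cpower lam b)))); [reflexivity|].
  rewrite Cmod_inv, Cmod_mult, Hp by now apply Cmult_neq_0.
  rewrite Rpower_Ropp, Rpower_plus, Rpower_1 by lra; reflexivity.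
- rewrite Rmult_comm, Rmult_assoc; apply Rmult_le_compat_l; [easy|].
  assert (0 <= Rabs (Im lam)) by apply Rabs_pos.
  rewrite !Rpower_Ropp.
  apply Rle_trans with (/ Rpower ((1 + Rabs (Im lam)) / 2) (1 + b)).
  + apply Rinv_le_contravar; [apply exp_pos|].
    apply Rle_Rpower_l; lra.
  + apply Req_le; unfold Rdiv; rewrite <- Rpower_mult_distr by lra.
    replace (Rpower (/ 2) (1 + b)) with (/ Rpower 2 (1 + b)).
    * field; split; apply Rgt_not_eq, exp_pos.
    * rewrite <- Rpower_Ropp; unfold Rpower; rewrite ln_Rinv by lra; f_equal; ring.
Qed.

(** * Integrated semigroups of two equivalent sequences of generators *)

Lemma A5_half_plane_resolvent (X : CompleteNormedModule C_AbsRing) (omega : R)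
  (A : nat -> closed_operator X) (n : nat) (lam : C) :
  A5 omega A -> omega < Re lam -> resolvent_set (A n) lam.
Proof. intros H Hl; destruct (A5_half_plane_bound H) as [b [_ [M [_ HM]]]]; now apply HM. Qed.

(** The threshold [l0], about which nothing is known, gives way to [omega] and the growth exponent
    [w], and real parameters to complex ones. *)
Lemma generates_laplace (X : CompleteNormedModule C_AbsRing) (omega w l0 : R)
  (A : nat -> closed_operator X) (S : nat -> R -> X -> X) (n : nat) (x : X) (lam : C) :
  A5 omega A -> 0 < w ->
  (forall n t, half_line t -> is_linear (S n t)) ->
  (forall n x, continuous_on half_line (fun t => S n t x)) ->
  (forall n, is_finite (exp_sup_op w (S n))) ->
  (forall lam : R, l0 < lam -> forall n (x : X), exists J : X,
      is_RInt_gen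
        (fun t => scal (RtoC (exp (- lam * t)) : C_AbsRing) (S n t x) : realification X)
        (at_point 0) (Rbar_locally p_infty) (J : realification X) /\
      resolvent (A n) lam x = scal (RtoC lam : C_AbsRing) J) ->
  omega < Re lam -> w < Re lam ->
  int_lim (fun s => scal (cexp lam s : C_AbsRing) (S n (Rabs s) x) : realification X)
     (scal (Cinv lam : C_AbsRing) (resolvent (A n) lam x) : realification X).
Proof.
intros hA Hw linS contS finS genS Hlam1 Hlam2.
assert (Ho := A5_omega_pos hA).
pose (l1 := Rmax omega l0).
assert (Hl1 : omega <= l1) by apply Rmax_l.
assert (Hl2 : l0 <= l1) by apply Rmax_r.
(* Beyond [l1] both the real Laplace formula and the resolvent are available; [l1 + 1] serves as the
   auxiliary point [mu]. *)
apply (@laplace_resolvent X (A n) (fun s => S n (Rabs s) x) x (l1 + 1) l1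
   (real (exp_sup_op w (S n)) * norm x) w lam); trivial; try lra.
- intros s; apply (@continuous_on_half_line_Rabs (realif_UniformSpace X) (fun t => S n t x)), contS.
- apply Rmult_le_pos; [exact (exp_sup_op_nonneg (finS n) (linS n))|apply norm_ge_0]. 
- intros s Hs; rewrite Rabs_pos_eq by easy; exact (exp_sup_op_bound x (finS n) (linS n) Hs).
- apply (A5_resolvent_set hA); lra.
- intros l Hl; apply (A5_resolvent_set hA); lra.
- intros l Hl; destruct (genS l ltac:(lra) n x) as [J [HJ1 HJ2]].
  apply int_lim_of_gen in HJ1.
  refine (@eq_ind (realification X) _ (fun J => int_lim _ J) _ _ _).
  + refine (int_lim_ext _ HJ1); intros s Hs.
    rewrite cexp_RtoC, Rabs_pos_eq by lra; now rewrite Ropp_mult_distr_l.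
  + change (J = scal (RtoC (/ l) : C_AbsRing) (resolvent (A n) l x)).
    rewrite HJ2, RtoC_inv by lra; module_coefs X; field.
    intros E; apply RtoC_inj in E; lra.
- now apply A5_half_plane_resolvent with omega.
Qed.

Lemma exp_sup_le (X : CompleteNormedModule C_AbsRing) (w D : R) (F : R -> X) :
  (forall t, 0 <= t -> norm (F t) <= D * exp (w * t)) ->
  is_finite (exp_sup w F) /\ 0 <= real (exp_sup w F) <= D.
Proof.
intros H.
assert (H1 : forall t, half_line t -> norm (scal (RtoC (exp (- w * t)) : C_AbsRing) (F t)) <= D).
{ intros t Ht; rewrite norm_scal_RtoC by apply exp_pos.
  replace D with (exp (- w * t) * (D * exp (w * t))).
  - apply Rmult_le_compat_l; [left; apply exp_pos|now apply H].
  - transitivity (D * (exp (- w * t) * exp (w * t))); [ring|].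
    rewrite <- exp_plus; replace (- w * t + w * t) with 0 by ring; rewrite exp_0; ring. }
assert (H0 : half_line 0) by apply Rle_refl.
assert (Hfin := sup_over_finite H0 H1).
change (is_finite (exp_sup w F)) in Hfin; split; [easy|].
assert (U := @sup_over_ub R half_line (fun t => norm (scal (RtoC (exp (- w * t)) : C_AbsRing) (F t))) 0 H0).
assert (V := sup_over_le H1).
change (Rbar_le (exp_sup w F) D) in V.
match type of U with Rbar_le _ ?s => change s with (exp_sup w F) in U end.
rewrite <- Hfin in U, V; simpl in U, V; split; [|easy].
apply Rle_trans with (2 := U), norm_ge_0.
Qed.

Lemma continuous_on_minus (X : CompleteNormedModule C_AbsRing) (f g : R -> X) :
  continuous_on half_line f -> continuous_on half_line g ->
  continuous_on half_line (fun t => minus (f t) (g t)).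
Proof.
intros cf cg t Ht; unfold minus.
apply (filterlim_comp_2 _ _ _ (cf t Ht)
  (filterlim_comp _ _ _ _ _ _ _ _ (cg t Ht) (@filterlim_opp C_AbsRing X (g t)))).
apply (@filterlim_plus C_AbsRing X).
Qed.

Theorem theorem4p5 (X : CompleteNormedModule C_AbsRing) (omega : R)
  (A At : nat -> closed_operator X) (S St : nat -> R -> X -> X)
  (hA : A5 omega A) (hAt : A5 omega At)
  (hS : generates A S) (hSt : generates At St)
  (hsim : sim0_op omega A At) :
  sim_semigroup omega A At S St.
Proof.
destruct hS as [[linS [contS [w1 [hw1 [finS pbS]]]]] [l1 genS]].
destruct hSt as [[linT [contT [w2 [hw2 [finT pbT]]]]] [l2 genT]].
destruct hsim as [[[D HD] [Hdom _]] [b [Hb Hdiff]]].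
assert (Ho := A5_omega_pos hA).
split.
(* The range of a resolvent is the domain of its operator, so (RE1) and (RE2) come from the domain
   conditions in [sim_op]. *)
2:{ intros lam Hlam; split.
    - exists D; intros n x; destruct (HD n x) as [H1 H2].
      assert (R1 := @resolvent_range X (A n) lam x (A5_resolvent_set hA n Hlam)).
      assert (R2 := @resolvent_range X (At n) lam x (A5_resolvent_set hAt n Hlam)).
      tauto.
    - intros x.
      assert (R1 := @seq_range_seq_dom X A lam x (fun n => A5_resolvent_set hA n Hlam)).
      assert (R2 := @seq_range_seq_dom X At lam x (fun n => A5_resolvent_set hAt n Hlam)).
      specialize (Hdom x); tauto. }
intros x Hx.
pose (kap := Rmax w1 w2).
assert (Hk1 : w1 <= kap) by apply Rmax_l.
assert (Hk2 : w2 <= kap) by apply Rmax_r.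
(* This bound is polynomial in [n] and gives moderateness; convergence to zero is obtained
   separately, with a larger exponent. *)
pose (B := fun n => (real (exp_sup_op w1 (S n)) + real (exp_sup_op w2 (St n))) * norm (x n)).
assert (B1 : forall n, 0 <= real (exp_sup_op w1 (S n))) by exact (fun n => exp_sup_op_nonneg (finS n) (linS n)).
assert (B2 : forall n, 0 <= real (exp_sup_op w2 (St n))) by exact (fun n => exp_sup_op_nonneg (finT n) (linT n)).
assert (B0 : forall n, 0 <= B n).
{ intros n; apply Rmult_le_pos; [specialize (B1 n); specialize (B2 n); lra|apply norm_ge_0]. }
assert (HB : forall n t, 0 <= t ->
  norm (minus (S n t (x n)) (St n t (x n))) <= B n * exp (kap * t)).
{ intros n t Ht.
  assert (N1 := exp_sup_op_bound (x n) (finS n) (linS n) Ht).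
  assert (N2 := exp_sup_op_bound (x n) (finT n) (linT n) Ht).
  assert (E1 : exp (w1 * t) <= exp (kap * t)) by (apply exp_le; nra).
  assert (E2 : exp (w2 * t) <= exp (kap * t)) by (apply exp_le; nra).
  assert (P := @norm_ge_0 C_AbsRing X (x n)); specialize (B1 n); specialize (B2 n).
  unfold minus; apply Rle_trans with (1 := @norm_triangle C_AbsRing X _ _).
  rewrite (@norm_opp C_AbsRing X); unfold B; rewrite !Rmult_plus_distr_r.
  apply Rplus_le_compat.
  - apply Rle_trans with (1 := N1), Rmult_le_compat_l; [now apply Rmult_le_pos|easy].
  - apply Rle_trans with (1 := N2), Rmult_le_compat_l; [now apply Rmult_le_pos|easy]. }
split; [split|].
- intros n; apply continuous_on_minus; [apply contS|apply contT].
- exists kap; split; [lra|].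
  split; [intros n; apply (@exp_sup_le X kap (B n)), HB|].
  apply poly_bounded_le with (v := fun n => Finite (B n)).
  { intros n; destruct (@exp_sup_le X kap (B n) _ (HB n)) as [F [_ H]]; now rewrite <- F. }
  apply poly_bounded_mult; [intros n; specialize (B1 n); specialize (B2 n); lra| | |exact Hx].
  + intros n; apply norm_ge_0.
  + apply poly_bounded_plus.
    * apply poly_bounded_le with (2 := pbS); intros n; rewrite (finS n); apply Rbar_le_refl.
    * apply poly_bounded_le with (2 := pbT); intros n; rewrite (finT n); apply Rbar_le_refl.
(* The line [Re lam = c] lies to the right of [omega], [w1] and [w2]; the added 1 also gives
   [kap <= c - 1] and, as [omega > 0], [1 <= Re lam]. *)
- pose (c := Rmax omega kap + 1).
  assert (Hc1 : omega + 1 <= c) by (pose proof (Rmax_l omega kap); unfold c; lra).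
  assert (Hc2 : kap + 1 <= c) by (pose proof (Rmax_r omega kap); unfold c; lra).
  exists c; split; [lra|]; intros eps.
  (* The constant of [laplace_inversion_bound] times [Rpower 2 (1 + b)] from [norm_le_of_Cpower]; it
     depends on neither [n] nor [t]. *)
  pose (C0 := 2 * exp 1 * (Rpower 2 (1 + b) * (1 + 2 / b))).
  assert (HC0 : 0 < C0).
  { assert (0 < 2 / b) by (apply Rdiv_lt_0_compat; lra).
    unfold C0; repeat apply Rmult_lt_0_compat; try apply exp_pos; lra. }
  assert (He := cond_pos eps).
  (* The factor 2 turns the non-strict final bound [eps / 2] into a strict one by [eps]. *)
  assert (Hdel : 0 < eps / (2 * C0)) by (apply Rdiv_lt_0_compat; lra).
  specialize (Hdiff x Hx (mkposreal _ Hdel)).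
  apply filter_imp with (2 := Hdiff); intros n Hn; simpl in Hn.
  set (del := eps / (2 * C0)) in *.
  assert (Hsup : forall lam : C, omega < Re lam ->
    norm (scal (Cpower lam b : C_AbsRing)
      (minus (resolvent (A n) lam (x n)) (resolvent (At n) lam (x n)))) <= del).
  { intros lam Hlam.
    assert (U := @sup_over_ub C (half_plane omega) (fun lam => norm (scal (Cpower lam b : C_AbsRing)
      (minus (resolvent (A n) lam (x n)) (resolvent (At n) lam (x n))))) lam Hlam).
    (* An infinite supremum contradicts [Hn]. *)
    destruct sup_over as [s| |]; simpl in U, Hn; [|easy|easy].
    apply Rle_trans with (1 := U); pose proof (Rle_abs s); lra. }
  assert (Hfinal : forall t, 0 <= t ->
    norm (minus (S n t (x n)) (St n t (x n))) <= (C0 * del) * exp (c * t)).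
  { intros t Ht.
    pose (N := fun s => minus (S n (Rabs s) (x n)) (St n (Rabs s) (x n)) : realification X).
    assert (cS : forall s, continuous (fun s => S n (Rabs s) (x n) : realification X) s).
    { intros s; apply (@continuous_on_half_line_Rabs (realif_UniformSpace X) (fun t => S n t (x n))), contS. }
    assert (cT : forall s, continuous (fun s => St n (Rabs s) (x n) : realification X) s).
    { intros s; apply (@continuous_on_half_line_Rabs (realif_UniformSpace X) (fun t => St n t (x n))), contT. }
    assert (Q : norm (N t) <= 2 * exp 1 * ((del * Rpower 2 (1 + b)) * (1 + 2 / b)) * exp (c * t)).
    { apply (@laplace_inversion_bound X N c b _ (B n)); trivial.
      - intros s; apply (@continuous_minus R_UniformSpace R_AbsRing (realif_NormedModule X)); auto.
      - intros s Hs; unfold N; rewrite Rabs_pos_eq by easy.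
        apply Rle_trans with (1 := HB n s Hs), Rmult_le_compat_l; [apply B0|].
        apply exp_le, Rmult_le_compat_r; lra.
      - apply Rmult_le_pos; [lra|left; apply exp_pos].
      - intros sg.
        pose (lam := (c, sg) : C).
        exists (scal (Cinv lam : C_AbsRing)
          (minus (resolvent (A n) lam (x n)) (resolvent (At n) lam (x n))) : realification X); split.
        + assert (I1 := @generates_laplace X omega w1 l1 A S n (x n) lam hA hw1 linS contS finS genS
            ltac:(simpl; lra) ltac:(simpl; lra)).
          assert (I2 := @generates_laplace X omega w2 l2 At St n (x n) lam hAt hw2 linT contT finT genT
            ltac:(simpl; lra) ltac:(simpl; lra)).
          assert (c1 : forall s, continuous (fun s => scal (cexp lam s : C_AbsRing) (S n (Rabs s) (x n)) : realification X) s).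
          { intros s; now apply (@continuous_cexp_scal X lam (fun s => S n (Rabs s) (x n) : realification X)). }
          assert (c2 : forall s, continuous (fun s => scal (cexp lam s : C_AbsRing) (St n (Rabs s) (x n)) : realification X) s).
          { intros s; now apply (@continuous_cexp_scal X lam (fun s => St n (Rabs s) (x n) : realification X)). }
          assert (I3 := int_lim_clinear (is_linear_scal_C X (Copp 1)) c2 I2).
          assert (I := int_lim_plus c1
            (fun s => @continuous_clinear X _ _ s (is_linear_scal_C X (Copp 1)) (c2 s)) I1 I3).
          refine (@eq_ind (realification X) _ (fun J => int_lim _ J) _ _ _).
          * refine (int_lim_ext _ I); intros s _; unfold N.
            change (plus (scal (cexp lam s : C_AbsRing) (S n (Rabs s) (x n)))
              (scal (Copp 1 : C_AbsRing) (scal (cexp lam s : C_AbsRing) (St n (Rabs s) (x n)))) =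
              scal (cexp lam s : C_AbsRing) (minus (S n (Rabs s) (x n)) (St n (Rabs s) (x n)))).
            set (e := cexp lam s); module_coefs X; ring.
          * change (plus (scal (Cinv lam : C_AbsRing) (resolvent (A n) lam (x n)))
              (scal (Copp 1 : C_AbsRing) (scal (Cinv lam : C_AbsRing) (resolvent (At n) lam (x n)))) =
              scal (Cinv lam : C_AbsRing) (minus (resolvent (A n) lam (x n)) (resolvent (At n) lam (x n)))).
            set (e := Cinv lam); module_coefs X; ring.
        + apply (@norm_le_of_Cpower X lam b del); [simpl; lra|easy|apply Hsup; simpl; lra]. }
    unfold N in Q; rewrite Rabs_pos_eq in Q by easy.
    apply Rle_trans with (1 := Q), Req_le; unfold C0; ring. }
  destruct (@exp_sup_le X c (C0 * del) _ Hfinal) as [F [F0 F1]].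
  rewrite <- F; simpl; rewrite Rabs_pos_eq by easy.
  apply Rle_lt_trans with (1 := F1).
  unfold del; replace (C0 * (eps / (2 * C0))) with (eps / 2) by (field; lra); lra.
Qed.
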